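(* Let $(\mathfrak{g},\delta)$ be the Lie bialgebra with basis $\{M,P_0,P_1,K\}$, Lie brackets $[P_0,P_1]=0$, $[K,P_0]=P_1$, $[K,P_1]=M+P_0$, $[M,\cdot]=0$, and cocommutator $\delta(M)=\alpha M\wedge P_1+\alpha P_0\wedge P_1$, $\delta(P_0)=\delta(P_1)=0$, $\delta(K)=\alpha K\wedge P_1$. Then $(\mathfrak{g},\delta)$ is quantized by the quantum algebra $U_\alpha(\mathfrak{g})$ (a Hopf algebra deformation of $U(\mathfrak{g})$ generated by $M,P_0,P_1,K$) with coproducts $$\begin{aligned} \Delta(M)&=M\otimes1+e^{-\alpha P_1}\otimes M+(e^{-\alpha P_1}-1)\otimes P_0,\\ \Delta(P_0)&=P_0\otimes1+1\otimes P_0,\\ \Delta(P_1)&=P_1\otimes1+1\otimes P_1,\\ \Delta(K)&=K\otimes e^{\alpha P_1}+1\otimes K, \end{aligned}$$ and compatible commutation relations $$\begin{gathered} [P_0,P_1]=0,\quad [M,P_0]=0,\quad [M,P_1]=0,\\ [K,P_0]=\frac{e^{\alpha P_1}-1}{\alpha},\quad [K,P_1]=(M+P_0)e^{\alpha P_1},\\ [K,M]=-\left(\frac{\cosh(\alpha P_1)-1}{\alpha}+\frac{\alpha}{2}(M+P_0)^2e^{\alpha P_1}\right). \end{gathered}$$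
   Context: $U_\alpha(\mathfrak{g})$ is understood formally in $\alpha$: a topologically free $\mathbb{R}[[\alpha]]$-module with topological PBW basis $M^aP_0^bP_1^cK^d$, all functions of $\alpha P_1$ being power series in $\alpha$. ''Compatible'' means that $\Delta$ extends to an algebra homomorphism, i.e. $\Delta([X,Y])=[\Delta(X),\Delta(Y)]$ for all $X,Y$; together with coassociativity this gives a Hopf algebra, the counit and antipode being determined by the Hopf algebra axioms. That this Hopf algebra is a quantization of $(\mathfrak{g},\delta)$ means: at order $\alpha^0$ the commutation relations are the Lie brackets of $\mathfrak{g}$ and the coproduct is the primitive one, and the skew-symmetric part of the first order in $\alpha$ of the coproduct on generators is the cocommutator, $\Delta-\tau\circ\Delta=\delta \bmod \alpha^2$, where $\tau(X\otimes Y)=Y\otimes X$ and $X\wedge Y=X\otimes Y-Y\otimes X$. *)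

(* Defs.v *)
From HB Require Import structures.
From mathcomp Require Import all_boot all_order all_algebra.
From mathcomp Require Import finmap.
From mathcomp.multinomials Require Import monalg.
From mathcomp Require Import boolp functions reals.
From mathcomp Require Import ring.

Set Implicit Arguments.
Unset Strict Implicit.
Unset Printing Implicit Defensive.

Import GRing.Theory.
Local Open Scope ring_scope.

Section Triangle.
Variable V : zmodType.

Lemma sum_triangle (F : nat -> nat -> nat -> V) n :
  \sum_(i < n.+1) \sum_(j < (n - i).+1) F i j (n - i - j)%N =
  \sum_(k < n.+1) \sum_(i < k.+1) F i (k - i)%N (n - k)%N.
Proof.
have E1 (i : 'I_n.+1) : \sum_(j < (n - i).+1) F i j (n - i - j)%N =
    \sum_(0 <= k < n.+1 | (i <= k)%N) F i (k - i)%N (n - k)%N.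
  have lein : (i <= n)%N by rewrite -ltnS.
  rewrite (big_cat_nat (n := i)) //=; last exact: leqW.
  rewrite [X in _ = X + _]big_nat_cond [X in _ = X + _]big1 ?add0r; last first.
    by move=> k /andP[/andP[_ ki] ik]; rewrite leqNgt ki in ik.
  rewrite -[in RHS](add0n (val i)) big_addn -subSn // big_mkord.
  apply: eq_big => [j|j _]; first by rewrite add0n leq_addl.
  by rewrite add0n addnK addnC subnDA.
under eq_bigr do rewrite E1.
rewrite -(big_mkord xpredT (fun i => \sum_(0 <= k < n.+1 | (i <= k)%N)
  F i (k - i)%N (n - k)%N)).
rewrite (exchange_big_dep_nat xpredT) //= big_mkord; apply: eq_bigr => k _.
rewrite big_mkord (big_ord_widen n.+1 (fun i => F i (k - i)%N (n - k)%N)) //.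
Qed.

Lemma sum_rev (F : nat -> nat -> V) n :
  \sum_(i < n.+1) F i (n - i)%N = \sum_(i < n.+1) F (n - i)%N i.
Proof.
rewrite (reindex_inj rev_ord_inj) /=; apply: eq_bigr => i _.
by rewrite subSS subKn // -ltnS.
Qed.
End Triangle.

(* The ring R[[alpha]]: s n is the coefficient of alpha ^ n. *)
Definition fps (R : comNzRingType) : Type := nat -> R.

Section Fps.
Variable R : comNzRingType.
HB.instance Definition _ := GRing.Zmodule.copy (fps R) (nat -> R).
Implicit Types (a b c : fps R).

Lemma fpsDE a b n : (a + b) n = a n + b n. Proof. by []. Qed.

Definition fpsC (x : R) : fps R := fun n => if n == 0 then x else 0.
Definition fps_mul a b : fps R := fun n => \sum_(i < n.+1) a i * b (n - i)%N.

Fact fps_mulA : associative fps_mul.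
Proof.
move=> a b c; apply/funext => n; rewrite /fps_mul.
under eq_bigr do rewrite big_distrr /=.
rewrite (sum_triangle (fun i j k => a i * (b j * c k))).
by apply: eq_bigr => k _; rewrite big_distrl /=; apply: eq_bigr => i _; rewrite mulrA.
Qed.

Fact fps_mulC : commutative fps_mul.
Proof.
move=> a b; apply/funext => n; rewrite /fps_mul (sum_rev (fun i j => a i * b j)).
by apply: eq_bigr => i _; rewrite mulrC.
Qed.

Fact fps_mul1 : left_id (fpsC 1) fps_mul.
Proof.
move=> a; apply/funext => n; rewrite /fps_mul big_ord_recl /= mul1r subn0.
by rewrite big1 ?addr0 // => i _; rewrite mul0r.
Qed.

Fact fps_mulDl : left_distributive fps_mul +%R.
Proof.
move=> a b c; apply/funext => n.
rewrite fpsDE /fps_mul -big_split /=.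
by apply: eq_bigr => i _; rewrite mulrDl.
Qed.

Fact fps_oner_neq0 : fpsC 1 != 0.
Proof. by apply/eqP => /(congr1 (fun a => a 0)) /eqP; rewrite oner_eq0. Qed.

HB.instance Definition _ := GRing.Zmodule_isComNzRing.Build (fps R)
  fps_mulA fps_mulC fps_mul1 fps_mulDl fps_oner_neq0.

Definition alpha : fps R := fun n => (n == 1)%:R.
End Fps.
Arguments alpha {R}.

(* The topologically free R[[alpha]]-module with topological basis B, i.e.   *)
(* V[[alpha]] for V the free R-module on B: x n is the coefficient of        *)
(* alpha ^ n, a finite R-linear combination of elements of B.                *)
Definition tfree (R : comNzRingType) (B : choiceType) : Type :=
  nat -> {malg R[B]}.

Section Module.
Variables (R : comNzRingType) (B : choiceType).
HB.instance Definition _ := GRing.Zmodule.copy (tfree R B) (nat -> {malg R[B]}).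
Implicit Types (a b : fps R) (x y : tfree R B).

Lemma tfreeDE x y n : (x + y) n = x n + y n. Proof. by []. Qed.

Definition tfree_scale a x : tfree R B :=
  fun n => \sum_(i < n.+1) a i *: x (n - i)%N.

Fact tfree_scaleA a b x : tfree_scale a (tfree_scale b x) = tfree_scale (a * b) x.
Proof.
apply/funext => n; rewrite /tfree_scale.
under eq_bigr do rewrite scaler_sumr.
rewrite (sum_triangle (fun i j k => a i *: (b j *: x k))).
by apply: eq_bigr => k _; rewrite scaler_suml; apply: eq_bigr => i _; rewrite scalerA.
Qed.

Fact tfree_scale1 : left_id 1 tfree_scale.
Proof.
move=> x; apply/funext => n; rewrite /tfree_scale big_ord_recl /= scale1r subn0.
by rewrite big1 ?addr0 // => i _; rewrite scale0r.
Qed.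

Fact tfree_scaleDr : right_distributive tfree_scale +%R.
Proof.
move=> a x y; apply/funext => n.
rewrite tfreeDE /tfree_scale -big_split /=.
by apply: eq_bigr => i _; rewrite scalerDr.
Qed.

Fact tfree_scaleDl x : {morph tfree_scale^~ x : a b / a + b}.
Proof.
move=> a b; apply/funext => n.
rewrite tfreeDE /tfree_scale -big_split /=.
by apply: eq_bigr => i _; rewrite scalerDl.
Qed.

HB.instance Definition _ := GRing.Zmodule_isLmodule.Build (fps R) (tfree R B)
  tfree_scaleA tfree_scale1 tfree_scaleDr tfree_scaleDl.

Lemma tfreeZE a x n : (a *: x) n = \sum_(i < n.+1) a i *: x (n - i)%N.
Proof. by []. Qed.

Definition tbasis (k : B) : tfree R B := fun n => if n == 0 then << k >> else 0.

Definition eqmod (m : nat) x y := forall n, (n < m)%N -> x n = y n.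

(* Division by alpha; meaningful on the multiples of alpha, i.e. when x 0 = 0. *)
Definition divalpha x : tfree R B := fun n => x n.+1.

End Module.
Arguments tbasis {R B} k.

(* The R[[alpha]]-linear, hence alpha-adically continuous, extension of      *)
(* k |-> f k to the whole module.                                            *)
HB.lock Definition tlin (R : comNzRingType) (B C : choiceType)
    (f : B -> tfree R C) (x : tfree R B) : tfree R C :=
  fun n => \sum_(i < n.+1) \sum_(k <- msupp (x i)) (x i)@_k *: f k (n - i)%N.

Section Linear.
Variables (R : comNzRingType) (B C : choiceType).
Implicit Types (f g : B -> tfree R C) (x y : tfree R B).

Let mlin (V : lmodType R) (h : B -> V) (u : {malg R[B]}) : V :=
  \sum_(k <- msupp u) u@_k *: h k.

Let mlinEw (V : lmodType R) (h : B -> V) u (d : {fset B}) :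
  (msupp u `<=` d)%fset -> mlin h u = \sum_(k <- d) u@_k *: h k.
Proof.
move=> le; rewrite [LHS](big_fset_incl _ le) => //= k kd /mcoeff_outdom ->.
by rewrite scale0r.
Qed.

Let mlin_linear (V : lmodType R) (h : B -> V) a u v :
  mlin h (a *: u + v) = a *: mlin h u + mlin h v.
Proof.
set d := (msupp (a *: u + v) `|` msupp u `|` msupp v)%fset.
have le1 : (msupp (a *: u + v) `<=` d)%fset by apply/fsubsetP=> k; rewrite !inE => ->.
have le2 : (msupp u `<=` d)%fset by apply/fsubsetP=> k; rewrite !inE => ->; rewrite orbT.
have le3 : (msupp v `<=` d)%fset by apply/fsubsetP=> k; rewrite !inE => ->; rewrite orbT.
rewrite (mlinEw _ le1) (mlinEw _ le2) (mlinEw _ le3) scaler_sumr -big_split /=.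
by apply: eq_bigr => k _; rewrite mcoeffD mcoeffZ scalerDl scalerA.
Qed.

Let mlinD (V : lmodType R) (h : B -> V) u v : mlin h (u + v) = mlin h u + mlin h v.
Proof. by rewrite -[u]scale1r mlin_linear !scale1r. Qed.

Let mlin0 (V : lmodType R) (h : B -> V) : mlin h 0 = 0.
Proof. by rewrite /mlin msupp0 big_seq_fset0. Qed.

Let mlinZ (V : lmodType R) (h : B -> V) a u : mlin h (a *: u) = a *: mlin h u.
Proof. by rewrite -[a *: u]addr0 mlin_linear mlin0 addr0. Qed.

Let mlin_sum (V : lmodType R) (h : B -> V) n (F : 'I_n -> {malg R[B]}) :
  mlin h (\sum_(i < n) F i) = \sum_(i < n) mlin h (F i).
Proof. exact: (big_morph (mlin h) (@mlinD V h) (@mlin0 V h)). Qed.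

Let tlinE f x n : tlin f x n = \sum_(i < n.+1) mlin (fun k => f k (n - i)%N) (x i).
Proof. by rewrite unlock. Qed.

Lemma tlinD f x y : tlin f (x + y) = tlin f x + tlin f y.
Proof.
apply/funext => n; rewrite tfreeDE !tlinE -big_split /=.
by apply: eq_bigr => i _; rewrite -mlinD.
Qed.

Lemma tlinZ f a x : tlin f (a *: x) = a *: tlin f x.
Proof.
apply/funext => n; rewrite tlinE.
under eq_bigr => i _ do rewrite tfreeZE mlin_sum.
rewrite -(sum_triangle
  (fun i j k => mlin (fun b => f b k) (a i *: x j))).
apply: eq_bigr => i _; rewrite tlinE scaler_sumr.
by apply: eq_bigr => j _; rewrite mlinZ.
Qed.

Lemma tlinP f a x y : tlin f (a *: x + y) = a *: tlin f x + tlin f y.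
Proof. by rewrite tlinD tlinZ. Qed.

Lemma tlin_is_linear f : linear (tlin f).
Proof. exact: tlinP. Qed.

HB.instance Definition _ f :=
  GRing.isLinear.Build (fps R) (tfree R B) (tfree R C) *:%R (tlin f)
    (tlin_is_linear f).

Lemma tlin_basis f k : tlin f (tbasis k) = f k.
Proof.
apply/funext => n; rewrite tlinE big_ord_recl /= subn0 big1 => [|i _]; last exact: mlin0.
by rewrite addr0 /mlin /tbasis /= msuppU oner_eq0 big_seq_fset1 mcoeffUU scale1r.
Qed.

Lemma alphaZ (D : choiceType) (x : tfree R D) n :
  (alpha *: x) n = if n is m.+1 then x m else 0.
Proof.
rewrite tfreeZE.
case: n => [|n]; first by rewrite big_ord1 scale0r.
rewrite !big_ord_recl /= scale0r add0r scale1r subn1 big1 ?addr0 // => i _.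
by rewrite /alpha /= scale0r.
Qed.

Let fpsCZ (D : choiceType) (c : R) (x : tfree R D) n : (fpsC c *: x) n = c *: x n.
Proof.
rewrite tfreeZE big_ord_recl /= subn0.
by rewrite big1 ?addr0 // => i _; rewrite scale0r.
Qed.

Lemma tlin_ext (f g : tfree R B -> tfree R C) :
  (forall a x y, f (a *: x + y) = a *: f x + f y) ->
  (forall a x y, g (a *: x + y) = a *: g x + g y) ->
  (forall k, f (tbasis k) = g (tbasis k)) -> f =1 g.
Proof.
move=> lf lg fg x.
have [h hE lh] : exists2 h : tfree R B -> tfree R C,
    (forall x, h x = f x - g x) & forall a x y, h (a *: x + y) = a *: h x + h y.
  exists (fun x => f x - g x) => // a u v.
  by rewrite lf lg scalerBr opprD addrACA.
have hb k : h (tbasis k) = 0 by rewrite hE fg subrr.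
have h0 : h 0 = 0 by have := lh (-1) 0 0; rewrite !scaleN1r addr0 oppr0 addNr.
suff: forall n x, h x n = 0.
  move=> hn; apply/eqP; rewrite -subr_eq0 -hE; apply/eqP.
  by apply/funext => n; rewrite hn.
have hD u v : h (u + v) = h u + h v by have := lh 1 u v; rewrite !scale1r.
have hZ a u : h (a *: u) = a *: h u by rewrite -[a *: u]addr0 lh h0 addr0.
have step u : h u = alpha *: h (divalpha u).
  have {1}-> : u = \sum_(k <- msupp (u 0)) fpsC (u 0)@_k *: tbasis k
      + alpha *: divalpha u.
    apply/funext => m; rewrite tfreeDE alphaZ fct_sumE.
    under eq_bigr do rewrite fpsCZ /tbasis.
    case: m => [|m]; last by rewrite big1 ?add0r // => k _; rewrite scaler0.
    rewrite addr0 {1}[u 0]monalgE; apply: eq_bigr => k _.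
    by apply/malgP => k'; rewrite mcoeffZ !mcoeffU mulr_natr.
  rewrite hD hZ (big_morph h hD h0) big1 ?add0r // => k _.
  by rewrite hZ hb scaler0.
by elim=> [|n IHn] u; rewrite step alphaZ.
Qed.
End Linear.

Section CompletedTensor.
Variable R : comNzRingType.

Lemma tbasis_neq0 (B : choiceType) (k : B) : tbasis k != 0 :> tfree R B.
Proof.
apply/eqP => /(congr1 (fun x => (x 0)@_k)) /eqP.
by rewrite /tbasis /= mcoeffUU mcoeff0 oner_eq0.
Qed.

Lemma tlin_fun_linear (B C : choiceType) (f g : B -> tfree R C) a x :
  tlin (fun k => a *: f k + g k) x = a *: tlin f x + tlin g x.
Proof.
apply: (tlin_ext (f := tlin _) (g := fun x => a *: tlin f x + tlin g x)).
- exact: tlinP.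
- move=> b u v; rewrite (tlinP f) (tlinP g) !scalerDr !scalerA (mulrC a b).
  by rewrite addrACA.
- by move=> k; rewrite !tlin_basis.
Qed.

(* The completed tensor product of tfree R B and tfree R C is               *)
(* tfree R (B * C); tens is the bilinear map sending basis elements b, c to  *)
(* (b, c).                                                                   *)
Definition tens (B C : choiceType) (x : tfree R B) (y : tfree R C) :
    tfree R (B * C)%type :=
  tlin (fun b => tlin (fun c => tbasis (b, c)) y) x.

Definition tens_map (B C B' C' : choiceType) (f : tfree R B -> tfree R B')
    (g : tfree R C -> tfree R C') : tfree R (B * C)%type -> tfree R (B' * C')%type :=
  tlin (fun p => tens (f (tbasis p.1)) (g (tbasis p.2))).

Definition tens_flip (B C : choiceType) :
    tfree R (B * C)%type -> tfree R (C * B)%type :=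
  tlin (fun p => tbasis (p.2, p.1)).

Definition tens_assoc (B C D : choiceType) :
    tfree R (B * C * D)%type -> tfree R (B * (C * D))%type :=
  tlin (fun p => tbasis (p.1.1, (p.1.2, p.2))).

Section TensTheory.
Variables B C : choiceType.

Lemma tensPl a (x x' : tfree R B) (y : tfree R C) :
  tens (a *: x + x') y = a *: tens x y + tens x' y.
Proof. by rewrite /tens tlinP. Qed.

Lemma tensPr a (x : tfree R B) (y y' : tfree R C) :
  tens x (a *: y + y') = a *: tens x y + tens x y'.
Proof.
rewrite /tens -tlin_fun_linear; congr tlin.
by apply/funext => b; rewrite tlinP.
Qed.

Lemma tens_basis (b : B) (c : C) : tens (tbasis b) (tbasis c) = tbasis (b, c).
Proof. by rewrite /tens !tlin_basis. Qed.

Lemma tens_ext (D : choiceType) (f g : tfree R (B * C)%type -> tfree R D) :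
  (forall a x y, f (a *: x + y) = a *: f x + f y) ->
  (forall a x y, g (a *: x + y) = a *: g x + g y) ->
  (forall x y, f (tens x y) = g (tens x y)) -> f =1 g.
Proof.
move=> lf lg fg; apply: tlin_ext => // -[b c].
by rewrite -tens_basis fg.
Qed.
End TensTheory.

(* Algebra structures over R[[alpha]] on tfree R B.                          *)
Record talgebra (B : choiceType) := TAlgebra {
  tmul : tfree R B -> tfree R B -> tfree R B;
  tone : tfree R B;
  tmulPl : forall a x x' y, tmul (a *: x + x') y = a *: tmul x y + tmul x' y;
  tmulPr : forall a x y y', tmul x (a *: y + y') = a *: tmul x y + tmul x y';
  tmul_assoc : associative tmul;
  tmul_1l : left_id tone tmul;
  tmul_1r : right_id tone tmul;
  tone_neq0 : tone != 0
}.

Definition tsort (B : choiceType) (A : talgebra B) : Type := tfree R B.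
Coercion tsort : talgebra >-> Sortclass.

Section AlgebraInstance.
Variables (B : choiceType) (A : talgebra B).

HB.instance Definition _ := GRing.Lmodule.copy (tsort A) (tfree R B).

Fact tmulDl : left_distributive (tmul A) (+%R : tfree R B -> _).
Proof. by move=> x y z; have := tmulPl A 1 x y z; rewrite !scale1r. Qed.

Fact tmulDr : right_distributive (tmul A) (+%R : tfree R B -> _).
Proof. by move=> x y z; have := tmulPr A 1 x y z; rewrite !scale1r. Qed.

HB.instance Definition _ := GRing.Zmodule_isNzRing.Build (tsort A)
  (@tmul_assoc B A) (@tmul_1l B A) (@tmul_1r B A) tmulDl tmulDr (@tone_neq0 B A).

Fact tscaleAl (a : fps R) (x y : A) : a *: (x * y) = (a *: x) * y.
Proof.
have := tmulPl A a x 0 y; have := tmulPl A (-1) 0 0 y.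
rewrite /= !scaleN1r !addr0 oppr0 addNr => ->; rewrite addr0 => E; exact: esym E.
Qed.

Fact tscaleAr (a : fps R) (x y : A) : a *: (x * y) = x * (a *: y).
Proof.
have := tmulPr A a x y 0; have := tmulPr A (-1) x 0 0.
rewrite /= !scaleN1r !addr0 oppr0 addNr => ->; rewrite addr0 => E; exact: esym E.
Qed.

HB.instance Definition _ := GRing.Lmodule_isLalgebra.Build (fps R) (tsort A) tscaleAl.
HB.instance Definition _ := GRing.Lalgebra_isAlgebra.Build (fps R) (tsort A) tscaleAr.

Definition tbracket (x y : A) : A := x * y - y * x.

End AlgebraInstance.

Section TensorAlgebra.
Variables (B C : choiceType) (A : talgebra B) (A' : talgebra C).
Implicit Types u v w : tfree R (B * C)%type.

(* The multiplication (x (x) y)(x' (x) y') = xx' (x) yy', see tens_mulE.     *)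
Definition tens_mul u v : tfree R (B * C)%type :=
  tlin (fun p : B * C => tlin (fun q : B * C =>
    tens (tmul A (tbasis p.1) (tbasis q.1)) (tmul A' (tbasis p.2) (tbasis q.2))) v) u.

Fact tens_mulPl a u v w : tens_mul (a *: u + v) w = a *: tens_mul u w + tens_mul v w.
Proof. by rewrite /tens_mul tlinP. Qed.

Fact tens_mulPr a u v w : tens_mul u (a *: v + w) = a *: tens_mul u v + tens_mul u w.
Proof.
rewrite /tens_mul -tlin_fun_linear; congr tlin.
by apply/funext => p; rewrite tlinP.
Qed.

Let tens_mulE' (x x' : tfree R B) (y y' : tfree R C) :
  tens_mul (tens x y) (tens x' y') = tens (tmul A x x') (tmul A' y y').
Proof.
apply: (tlin_ext (f := fun x => tens_mul (tens x y) (tens x' y'))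
  (g := fun x => tens (tmul A x x') (tmul A' y y'))).
- by move=> a u v; rewrite tensPl tens_mulPl.
- by move=> a u v; rewrite tmulPl tensPl.
move=> b; set x0 := tbasis b.
apply: (tlin_ext (f := fun y => tens_mul (tens x0 y) (tens x' y'))
  (g := fun y => tens (tmul A x0 x') (tmul A' y y'))).
- by move=> a u v; rewrite tensPr tens_mulPl.
- by move=> a u v; rewrite tmulPl tensPr.
move=> c; set y0 := tbasis c.
apply: (tlin_ext (f := fun x' => tens_mul (tens x0 y0) (tens x' y'))
  (g := fun x' => tens (tmul A x0 x') (tmul A' y0 y'))).
- by move=> a u v; rewrite tensPl tens_mulPr.
- by move=> a u v; rewrite tmulPr tensPl.
move=> b'; apply: (tlin_ext
  (f := fun y' => tens_mul (tens x0 y0) (tens (tbasis b') y'))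
  (g := fun y' => tens (tmul A x0 (tbasis b')) (tmul A' y0 y'))).
- by move=> a u v; rewrite tensPr tens_mulPr.
- by move=> a u v; rewrite tmulPr tensPr.
by move=> c'; rewrite !tens_basis /tens_mul !tlin_basis.
Qed.

Lemma tens_mulE (x x' : A) (y y' : A') :
  tens_mul (tens x y) (tens x' y') = tens (x * x') (y * y').
Proof. exact: tens_mulE'. Qed.

Let tens_one : tfree R (B * C)%type := tens (1 : A) (1 : A').

Fact tens_mulA : associative tens_mul.
Proof.
move=> u v w.
apply: (tens_ext (f := fun u => tens_mul u (tens_mul v w))
  (g := fun u => tens_mul (tens_mul u v) w)) => [a x y|a x y|x y].
- by rewrite tens_mulPl.
- by rewrite !tens_mulPl.
apply: (tens_ext (f := fun v => tens_mul (tens x y) (tens_mul v w))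
  (g := fun v => tens_mul (tens_mul (tens x y) v) w)) => [a s t|a s t|x' y'].
- by rewrite tens_mulPl tens_mulPr.
- by rewrite tens_mulPr tens_mulPl.
apply: (tens_ext (f := fun w => tens_mul (tens x y) (tens_mul (tens x' y') w))
  (g := fun w => tens_mul (tens_mul (tens x y) (tens x' y')) w))
  => [a s t|a s t|x'' y''].
- by rewrite !tens_mulPr.
- by rewrite tens_mulPr.
by rewrite !tens_mulE' !tmul_assoc.
Qed.

Fact tens_mul1 : left_id tens_one tens_mul.
Proof.
apply: (tens_ext (f := tens_mul tens_one) (g := idfun)) => [a u v|//|x y].
  by rewrite tens_mulPr.
by rewrite tens_mulE' !tmul_1l.
Qed.

Fact tens_mulr1 : right_id tens_one tens_mul.
Proof.
apply: (tens_ext (f := fun u => tens_mul u tens_one) (g := idfun)) => [a u v|//|x y].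
  by rewrite tens_mulPl.
by rewrite tens_mulE' !tmul_1r.
Qed.

Fact tens_one_neq0 : tens_one != 0.
Proof.
have inh (D : choiceType) (E : talgebra D) : exists d : D, True.
  apply/not_existsP => nD; have /eqP := tone_neq0 E; apply.
  apply: (tlin_ext (f := idfun) (g := fun=> 0)) => [a u v //|a u v|d].
    by rewrite scaler0 addr0.
  by case: (nD d).
have [[b _] [c _]] := (inh _ A, inh _ A').
apply/eqP => E; have /eqP := @tbasis_neq0 _ (b, c); apply.
rewrite -(tens_mul1 (tbasis (b, c))) E.
by have := tens_mulPl (-1) 0 0 (tbasis (b, c)); rewrite !scaleN1r addr0 oppr0 addNr.
Qed.

Definition tens_algebra : talgebra (B * C)%type :=
  TAlgebra tens_mulPl tens_mulPr tens_mulA tens_mul1 tens_mulr1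
    tens_one_neq0.

End TensorAlgebra.
End CompletedTensor.

Section Hopf.
Variables (R : comNzRingType) (B : choiceType) (A : talgebra R B).

Definition tens_mu : tfree R (B * B)%type -> tfree R B :=
  tlin (fun p => tmul A (tbasis p.1) (tbasis p.2)).

Record hopf := Hopf {
  comul : {lrmorphism A -> tens_algebra A A};
  counit : {lrmorphism A -> (fps R)^o};
  antipode : {linear A -> A};
  comulA : forall x : A,
    tens_assoc (tens_map comul id (comul x)) = tens_map id comul (comul x);
  counitl : forall x : A,
    tlin (fun p => counit (tbasis p.1) *: tbasis p.2) (comul x) = x;
  counitr : forall x : A,
    tlin (fun p => counit (tbasis p.2) *: tbasis p.1) (comul x) = x;
  antipodel : forall x : A,
    tens_mu (tens_map antipode id (comul x)) = counit x *: (1 : A);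
  antipoder : forall x : A,
    tens_mu (tens_map id antipode (comul x)) = counit x *: (1 : A)
}.

End Hopf.

(* The free module k^n is 'rV[k]_n and its tensor square is 'M[k]_n, with    *)
(* x (x) y the rank one matrix x^T y, so that the flip is transposition.     *)
Section LieBialgebra.
Variables (k : comNzRingType) (n : nat).

Definition ltens (x y : 'rV[k]_n) : 'M[k]_n := x^T *m y.
Definition wedge (x y : 'rV[k]_n) : 'M[k]_n := ltens x y - ltens y x.
Definition ebase (i : 'I_n) : 'rV[k]_n := delta_mx 0 i.

(* (f (x) id + id (x) f) t for a linear map f.                               *)
Definition leibniz2 (f : 'rV[k]_n -> 'rV[k]_n) (t : 'M[k]_n) : 'M[k]_n :=
  let F := \matrix_(i < n) f (ebase i) in F^T *m t + t *m F.

(* Coordinates on e_p (x) e_q (x) e_r of (d (x) id) (d x).                   *)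
Definition cob_iter (d : 'rV[k]_n -> 'M[k]_n) (x : 'rV[k]_n) (p q r : 'I_n) : k :=
  \sum_(i < n) d x i r * d (ebase i) p q.

Record lieBialgebra := LieBialgebra {
  lie : 'rV[k]_n -> 'rV[k]_n -> 'rV[k]_n;
  cob : 'rV[k]_n -> 'M[k]_n;
  lie_linearl : forall y, linear (fun x => lie x y);
  lie_linearr : forall x, linear (lie x);
  lie_alt : forall x, lie x x = 0;
  lie_jacobi : forall x y z,
    lie x (lie y z) + lie y (lie z x) + lie z (lie x y) = 0;
  cob_linear : linear cob;
  cob_skew : forall x, (cob x)^T = - cob x;
  cob_jacobi : forall x p q r,
    cob_iter cob x p q r + cob_iter cob x q r p + cob_iter cob x r p q = 0;
  cob_cocycle : forall x y,
    cob (lie x y) = leibniz2 (lie x) (cob y) - leibniz2 (lie y) (cob x)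
}.

End LieBialgebra.

Definition iM : 'I_4 := @Ordinal 4 0 isT.
Definition iP0 : 'I_4 := @Ordinal 4 1 isT.
Definition iP1 : 'I_4 := @Ordinal 4 2 isT.
Definition iK : 'I_4 := @Ordinal 4 3 isT.

Section GBialgebra.
Variables (k : comNzRingType) (a : k).
Local Notation eM := (ebase k iM).
Local Notation eP0 := (ebase k iP0).
Local Notation eP1 := (ebase k iP1).
Local Notation eK := (ebase k iK).
Implicit Types x y z : 'rV[k]_4.

(* See g_lie_table and g_cob_table for the values on the basis.              *)
Definition g_lie x y : 'rV[k]_4 :=
  (x 0 iK * y 0 iP0 - x 0 iP0 * y 0 iK) *: eP1 +
  (x 0 iK * y 0 iP1 - x 0 iP1 * y 0 iK) *: (eM + eP0).

Definition g_cob x : 'M[k]_4 :=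
  x 0 iM *: (a *: wedge eM eP1 + a *: wedge eP0 eP1) +
  x 0 iK *: (a *: wedge eK eP1).

Let ord4P (P : 'I_4 -> Prop) : P iM -> P iP0 -> P iP1 -> P iK -> forall i, P i.
Proof.
move=> p0 p1 p2 p3 [[|[|[|[|//]]]] h].
- by rewrite (_ : Ordinal h = iM) //; apply: val_inj.
- by rewrite (_ : Ordinal h = iP0) //; apply: val_inj.
- by rewrite (_ : Ordinal h = iP1) //; apply: val_inj.
- by rewrite (_ : Ordinal h = iK) //; apply: val_inj.
Qed.

Let sum4 (F : 'I_4 -> k) : \sum_i F i = F iM + F iP0 + F iP1 + F iK.
Proof.
rewrite !big_ord_recl big_ord0 addr0 !addrA.
by congr (_ + _ + _ + _); congr F; apply: val_inj.
Qed.

Let lieE x y i : g_lie x y 0 i =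
  (x 0 iK * y 0 iP0 - x 0 iP0 * y 0 iK) * (i == iP1)%:R +
  (x 0 iK * y 0 iP1 - x 0 iP1 * y 0 iK) * ((i == iM)%:R + (i == iP0)%:R).
Proof. by rewrite !mxE !eqxx. Qed.

Let cobE x i j : g_cob x i j =
  a * (x 0 iM * (((i == iM)%:R + (i == iP0)%:R) * (j == iP1)%:R -
                 (i == iP1)%:R * ((j == iM)%:R + (j == iP0)%:R)) +
       x 0 iK * ((i == iK)%:R * (j == iP1)%:R - (i == iP1)%:R * (j == iK)%:R)).
Proof.
rewrite !mxE !big_ord1 !mxE !eqxx /=; ring.
Qed.

Let mxD m (A B : 'M[k]_(m, 4)) i j : (A + B) i j = A i j + B i j.
Proof. by rewrite mxE. Qed.
Let mxN m (A : 'M[k]_(m, 4)) i j : (- A) i j = - A i j.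
Proof. by rewrite mxE. Qed.
Let mxZ m c (A : 'M[k]_(m, 4)) i j : (c *: A) i j = c * A i j.
Proof. by rewrite mxE. Qed.
Let mx0 m i j : (0 : 'M[k]_(m, 4)) i j = 0.
Proof. by rewrite mxE. Qed.
Let mxT (A : 'M[k]_4) i j : A^T i j = A j i.
Proof. by rewrite mxE. Qed.
Let mxM (A B : 'M[k]_4) i j : (A *m B) i j =
  A i iM * B iM j + A i iP0 * B iP0 j + A i iP1 * B iP1 j + A i iK * B iK j.
Proof. by rewrite mxE sum4. Qed.
Let mxF z i j : (\matrix_(i < 4) g_lie z (ebase k i)) i j = g_lie z (ebase k i) 0 j.
Proof. by rewrite mxE. Qed.
Let ebaseE (i j : 'I_4) : ebase k i 0 j = (j == i)%:R.
Proof. by rewrite mxE eqxx. Qed.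
Let mxS := (lieE, cobE, ebaseE, mxF, mxD, mxN, mxZ, mx0, mxT, mxM).

Let simp := (mulr0, mulr1, addr0, add0r, subr0, sub0r, mul0r, mul1r).

Fact g_lie_linearl y : linear (fun x => g_lie x y).
Proof. by move=> c x z; apply/rowP=> i; rewrite !mxS; ring. Qed.

Fact g_lie_linearr x : linear (g_lie x).
Proof. by move=> c y z; apply/rowP=> i; rewrite !mxS; ring. Qed.

Fact g_lie_alt x : g_lie x x = 0.
Proof. by apply/rowP=> i; rewrite !mxS; ring. Qed.

Fact g_lie_jacobi x y z :
  g_lie x (g_lie y z) + g_lie y (g_lie z x) + g_lie z (g_lie x y) = 0.
Proof. by apply/rowP; apply: ord4P; rewrite !mxS -!val_eqE /= ?simp; ring. Qed.

Fact g_cob_linear : linear g_cob.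
Proof. by move=> c x y; apply/matrixP=> i j; rewrite !mxS; ring. Qed.

Fact g_cob_skew x : (g_cob x)^T = - g_cob x.
Proof. by apply/matrixP=> i j; rewrite !mxS; ring. Qed.

Fact g_cob_jacobi x p q r :
  cob_iter g_cob x p q r + cob_iter g_cob x q r p + cob_iter g_cob x r p q = 0.
Proof.
by rewrite /cob_iter !sum4 !mxS -!val_eqE /= ?simp; ring.
Qed.

Fact g_cob_cocycle x y : g_cob (g_lie x y) =
  leibniz2 (g_lie x) (g_cob y) - leibniz2 (g_lie y) (g_cob x).
Proof.
by apply/matrixP=> i j; rewrite /leibniz2 !mxS -!val_eqE /= ?simp; ring.
Qed.

Fact g_lie_table :
  [/\ g_lie eP0 eP1 = 0, g_lie eK eP0 = eP1, g_lie eK eP1 = eM + eP0 &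
      forall x, g_lie eM x = 0].
Proof.
by split=> [|||x]; apply/rowP=> i; rewrite !mxS -!val_eqE /= ?simp; ring.
Qed.

Fact g_cob_table :
  [/\ g_cob eM = a *: wedge eM eP1 + a *: wedge eP0 eP1, g_cob eP0 = 0,
      g_cob eP1 = 0 & g_cob eK = a *: wedge eK eP1].
Proof.
by rewrite /g_cob !ebaseE -!val_eqE /= !scale1r !scale0r ?addr0 ?add0r.
Qed.

Definition g_bialgebra : lieBialgebra k 4 :=
  LieBialgebra g_lie_linearl g_lie_linearr g_lie_alt g_lie_jacobi
    g_cob_linear g_cob_skew g_cob_jacobi g_cob_cocycle.

End GBialgebra.

Section Quantization.
Variables (R : comNzRingType) (B : choiceType) (A : talgebra R B) (n : nat).
Variable gen : 'I_n -> A.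

Definition gmap (X : 'rV[fps R]_n) : A := \sum_(i < n) X 0 i *: gen i.
Definition gmap2 (T : 'M[fps R]_n) : tens_algebra A A :=
  \sum_(i < n) \sum_(j < n) T i j *: (tens (gen i) (gen j) : tens_algebra A A).

(* The cocommutator cob L contains the factor alpha: L is a Lie bialgebra    *)
(* over R[[alpha]], with underlying module g[[alpha]].                       *)
Record quantizes (L : lieBialgebra (fps R) n) (H : hopf A) : Prop := {
  quantizes_bracket : forall X Y,
    eqmod 1 (tbracket (gmap X) (gmap Y)) (gmap (lie L X Y));
  quantizes_primitive : forall X,
    eqmod 1 (comul H (gmap X))
      (tens (gmap X) (1 : A) + tens (1 : A) (gmap X));
  quantizes_cobracket : forall X,
    eqmod 2 ((comul H (gmap X) : tfree R (B * B)%type)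
             - tens_flip (comul H (gmap X)))
      (gmap2 (cob L X))
}.

End Quantization.

Section Functions.
Variables (R : fieldType) (B : choiceType) (A : talgebra R B).
Implicit Type y : A.

(* The alpha-adic sum of the y ^ i / i!, for y a multiple of alpha: then     *)
(* y ^ i vanishes modulo alpha ^ i, so that the terms of index i > n do not  *)
(* contribute to the coefficient of alpha ^ n.                               *)
Definition texp y : A :=
  fun n => \sum_(i < n.+1) (i`!%:R)^-1 *: (y ^+ i : tfree R B) n.

Definition tcosh y : A := fpsC 2^-1 *: (texp y + texp (- y)).

End Functions.

(* (a, b, c, d) stands for the monomial M^a P0^b P1^c K^d.                   *)
Definition pbw : choiceType := (nat * nat * nat * nat)%type.

Section Ualpha.
Variables (R : fieldType) (A : talgebra R pbw).

Definition genM : A := tbasis ((1, 0, 0, 0)%N : pbw).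
Definition genP0 : A := tbasis ((0, 1, 0, 0)%N : pbw).
Definition genP1 : A := tbasis ((0, 0, 1, 0)%N : pbw).
Definition genK : A := tbasis ((0, 0, 0, 1)%N : pbw).
Definition generators (i : 'I_4) : A := nth 0 [:: genM; genP0; genP1; genK] i.

Local Notation M := genM.
Local Notation P0 := genP0.
Local Notation P1 := genP1.
Local Notation K := genK.
Local Notation aP1 := (alpha *: P1 : A).

Record Ualpha_algebra : Prop := {
  Ualpha_pbw : forall a b c d : nat,
    M ^+ a * P0 ^+ b * P1 ^+ c * K ^+ d = tbasis ((a, b, c, d) : pbw);
  Ualpha_P0P1 : tbracket P0 P1 = 0;
  Ualpha_MP0 : tbracket M P0 = 0;
  Ualpha_MP1 : tbracket M P1 = 0;
  Ualpha_KP0 : tbracket K P0 = divalpha (texp aP1 - 1);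
  Ualpha_KP1 : tbracket K P1 = (M + P0) * texp aP1;
  Ualpha_KM : tbracket K M =
    - ((divalpha (tcosh aP1 - 1) : A)
       + (alpha * fpsC 2^-1) *: ((M + P0) ^+ 2 * texp aP1))
}.

Record Ualpha_coproduct (H : hopf A) : Prop := {
  Ualpha_comulM : comul H M =
    tens M (1 : A) + tens (texp (- aP1)) M + tens (texp (- aP1) - 1) P0;
  Ualpha_comulP0 : comul H P0 = tens P0 (1 : A) + tens (1 : A) P0;
  Ualpha_comulP1 : comul H P1 = tens P1 (1 : A) + tens (1 : A) P1;
  Ualpha_comulK : comul H K = tens K (texp aP1) + tens (1 : A) K
}.

End Ualpha.

(* Main.v *)
Require Import Defs.
From HB Require Import structures.
From mathcomp Require Import all_boot all_order all_algebra.
From mathcomp Require Import finmap.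
From mathcomp.multinomials Require Import monalg.
From mathcomp Require Import boolp functions reals.

Set Implicit Arguments.
Unset Strict Implicit.
Unset Printing Implicit Defensive.

Import Order.TTheory GRing.Theory Num.Theory.
Local Open Scope ring_scope.

(* Put N = M + P0, E = exp (alpha P1) and E' = exp (- alpha P1). The relations
   become  alpha [K, P0] = E - 1,  [K, P1] = N E  and
   2 alpha [K, N] = E - E' - alpha^2 N^2 E:  M, P0, P1 generate a commutative
   algebra on which K acts by a derivation, so that U_alpha is an Ore extension.

   It is realised by operators on the module with basis M^a P0^b P1^c K^d: M, P0
   and P1 act by shifts, and K acts by a shift plus the sum of the [K, X] d/dX
   for X = M, P0, P1. The product x * y is then the operator of x applied to y.

   Its associativity and the universal property of U_alpha have the same source:
   a linear map sending M^a P0^b P1^c K^d v0 to m^a p0^b p1^c k^d w0, for two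
   representations of the relations, intertwines them; this follows by induction
   on the monomial, commuting K to the right.

   The universal property, applied to U (x) U, to R[[alpha]] and to the opposite
   algebra, gives the coproduct, the counit and the antipode, which is determined
   by S(K) = - K E' and S(N) = - N E. In terms of N the coproduct is
   N (x) 1 + E' (x) N, and its compatibility with the relations comes from
   E' (x) E' being group-like together with [K, E'] = - alpha N. Coassociativity,
   the counit and the antipode axioms each hold on a subalgebra, hence need only
   be checked on the generators. *)

(** * The alpha-adic topology *)

Section Adic.
Variable R : numFieldType.

Section Module.
Variable W : lmodType (fps R).
Implicit Types (x y z : W).

(** Divisibility instead of vanishing coefficients, so that congruences modulo powers of alpha make
    sense in every module over R[[alpha]]. On [tfree R B] the two notions agree, by [tfree_adiv] and
    [adiv_tfree]. *)
Definition adiv n x := exists z, x = alpha ^+ n *: z.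

(* The second clause is torsion-freeness: it lets one divide by alpha. *)
Definition adic_separated :=
  (forall x, (forall n, adiv n x) -> x = 0) /\
  (forall x, alpha *: x = 0 -> x = 0).

Lemma adiv0 n : adiv n 0.
Proof. by exists 0; rewrite scaler0. Qed.

Lemma adivD n x y : adiv n x -> adiv n y -> adiv n (x + y).
Proof. by move=> [u ->] [v ->]; exists (u + v); rewrite scalerDr. Qed.

Lemma adivZ n (a : fps R) x : adiv n x -> adiv n (a *: x).
Proof. by move=> [u ->]; exists (a *: u); rewrite !scalerA mulrC. Qed.

Lemma adivN n x : adiv n x -> adiv n (- x).
Proof. by rewrite -scaleN1r; apply: adivZ. Qed.

Lemma adivB n x y : adiv n x -> adiv n y -> adiv n (x - y).
Proof. by move=> ax ay; apply: adivD => //; apply: adivN. Qed.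

Lemma adiv_sum n I (r : seq I) (P : pred I) (F : I -> W) :
  (forall i, P i -> adiv n (F i)) -> adiv n (\sum_(i <- r | P i) F i).
Proof. by move=> aF; elim/big_ind: _ => //; [exact: adiv0|exact: adivD]. Qed.

Lemma adiv_alpha m n x : adiv n x -> adiv (m + n) (alpha ^+ m *: x).
Proof. by move=> [u ->]; exists u; rewrite scalerA exprD. Qed.

Lemma adiv_leq m n x : (m <= n)%N -> adiv n x -> adiv m x.
Proof.
by move=> /subnKC <- [u ->]; exists (alpha ^+ (n - m) *: u); rewrite scalerA -exprD.
Qed.

Lemma separated_eq x y : adic_separated -> (forall n, adiv n (x - y)) -> x = y.
Proof. by move=> [sep _] xy; apply/subr0_eq/sep. Qed.

Lemma alpha_inj x y : adic_separated -> alpha *: x = alpha *: y -> x = y.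
Proof.
by move=> [_ tf] xy; apply/subr0_eq/tf; rewrite scalerBr xy subrr.
Qed.

Lemma adiv_alpha_cancel n x :
  adic_separated -> adiv n.+1 (alpha *: x) -> adiv n x.
Proof.
by move=> sep [z xz]; exists z; apply: alpha_inj => //; rewrite xz exprS scalerA.
Qed.

End Module.

Lemma adiv_linear (V W : lmodType (fps R)) (f : {linear V -> W}) n x :
  adiv n x -> adiv n (f x).
Proof. by move=> [z ->]; exists (f z); rewrite linearZ. Qed.

(* The coefficient of y ^ i in exp (alpha y). *)
Definition expc i : fps R := alpha ^+ i * fpsC (i`!%:R)^-1.

Lemma fpsCZ (B : choiceType) (c : R) (x : tfree R B) n : (fpsC c *: x) n = c *: x n.
Proof.
rewrite tfreeZE big_ord_recl /= subn0.
by rewrite big1 ?addr0 // => i _; rewrite scale0r.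
Qed.

Lemma fpsCMn (c : R) n : fpsC c *+ n = fpsC (c *+ n).
Proof.
elim: n => [|n IH]; first by apply/funext => m; rewrite /fpsC mulr0n if_same.
by rewrite !mulrSr IH; apply/funext => m; rewrite fpsDE /fpsC; case: ifP; rewrite ?addr0.
Qed.

Lemma half_fps : fpsC (2^-1 : R) *+ 2 = 1.
Proof. by rewrite fpsCMn -[2^-1 *+ 2]mulr_natr mulVf ?pnatr_eq0. Qed.

Lemma double_half (W : lmodType (fps R)) (x : W) : (fpsC 2^-1 *: x) *+ 2 = x.
Proof. by rewrite scalerMnl half_fps scale1r. Qed.

Lemma double_inj (W : lmodType (fps R)) : injective (fun x : W => x *+ 2).
Proof.
by move=> x y /(congr1 (GRing.scale (fpsC 2^-1))); rewrite -!scalerMnr !double_half.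
Qed.

Lemma expc0 : expc 0 = 1.
Proof. by rewrite /expc expr0 mul1r fact0 invr1. Qed.

(** The differential equation of the exponential, read on coefficients; it drives
    [is_exp_bracket]. *)
Lemma expcS i : expc i.+1 *+ i.+1 = alpha * expc i.
Proof.
rewrite /expc -mulrnAr fpsCMn factS natrM invfM -[_ *+ _]mulr_natl mulVKf ?pnatr_eq0 //.
by rewrite exprS mulrA.
Qed.

Lemma fpsCM (c d : R) : fpsC c * fpsC d = fpsC (c * d).
Proof.
apply/funext => m; transitivity (\sum_(i < m.+1) fpsC c i * fpsC d (m - i)%N) => //.
rewrite big_ord_recl /= subn0 big1 ?addr0 => [|i _]; last by rewrite mul0r.
by rewrite /fpsC /=; case: eqP; rewrite ?mulr0.
Qed.

(** The binomial identity behind exp (y + z) = exp y exp z. *)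
Lemma expcM i j : expc (i + j) *+ 'C(i + j, i) = expc i * expc j.
Proof.
rewrite /expc -mulrnAr fpsCMn mulrACA -exprD fpsCM; congr (_ * fpsC _).
have f0 n : n`!%:R != 0 :> R by rewrite pnatr_eq0 -lt0n fact_gt0.
rewrite -[_ *+ _]mulr_natl -(bin_fact (leq_addr j i)) addKn !natrM.
by rewrite !invfM mulVKf // pnatr_eq0 -lt0n bin_gt0 leq_addr.
Qed.

Lemma tfree_adiv (B : choiceType) (x : tfree R B) n :
  (forall m, (m < n)%N -> x m = 0) -> adiv n x.
Proof.
elim: n x => [|n IH] x x0; first by exists x; rewrite expr0 scale1r.
have -> : x = alpha *: divalpha x.
  by apply/funext => -[|m]; rewrite alphaZ // x0.
by apply: (@adiv_alpha _ 1); apply: IH => m mn; apply: x0.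
Qed.

Lemma adiv_tfree (B : choiceType) (x : tfree R B) n m :
  adiv n x -> (m < n)%N -> x m = 0.
Proof.
move=> [u ->]; elim: n m => [//|n IH] [|m] mn.
  by rewrite exprS -scalerA alphaZ.
by rewrite exprS -scalerA alphaZ IH.
Qed.

Lemma tfree_separated (B : choiceType) : adic_separated (tfree R B).
Proof.
split=> [x ax|x ax]; first by apply/funext => n; apply: (adiv_tfree (ax n.+1)).
by apply/funext => n; have := congr1 (fun y => y n.+1) ax; rewrite alphaZ.
Qed.

Lemma fps_separated : adic_separated (fps R)^o.
Proof.
have aE (x : fps R) n : (alpha * x) n = if n is m.+1 then x m else 0.
  transitivity (\sum_(i < n.+1) alpha i * x (n - i)%N) => //.
  case: n => [|n]; first by rewrite big_ord1 mul0r.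
  rewrite !big_ord_recl /= mul0r add0r mul1r subn1 big1 ?addr0 // => i _.
  by rewrite /alpha /= mul0r.
split=> [x ax|x ax]; apply/funext => n.
  have [z ->] := ax n.+1.
  suff aX k m : (m < k)%N -> (alpha ^+ k * z) m = 0 by exact: aX.
  by elim: k m => [//|k IH] [|m] mk; rewrite exprS -mulrA aE //; apply: IH.
by have := congr1 (fun y : fps R => y n.+1) ax; rewrite [LHS]aE.
Qed.

Lemma tfree_decomp (B : choiceType) (u : tfree R B) :
  u = \sum_(k <- msupp (u 0)) fpsC (u 0)@_k *: tbasis k + alpha *: divalpha u.
Proof.
apply/funext => m; rewrite tfreeDE alphaZ fct_sumE.
under eq_bigr do rewrite fpsCZ /tbasis.
case: m => [|m]; last by rewrite big1 ?add0r // => k _; rewrite scaler0.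
rewrite addr0 {1}[u 0]monalgE; apply: eq_bigr => k _.
by apply/malgP => k'; rewrite mcoeffZ !mcoeffU mulr_natr.
Qed.

(** Modulo alpha every vector is a finite combination of basis vectors, so f - g at u is alpha times
    f - g at [divalpha u]. Iterating puts the difference in every alpha ^+ n W, hence makes it 0.
    The target W is any separated module, such as R[[alpha]] or an algebra. *)
Lemma tfree_ext (B : choiceType) (W : lmodType (fps R)) (f g : tfree R B -> W) :
  adic_separated W -> linear f -> linear g ->
  (forall k, f (tbasis k) = g (tbasis k)) -> f =1 g.
Proof.
move=> sep lf lg fg u; apply: separated_eq => // n; elim: n u => [|n IH] u.
  by exists (f u - g u); rewrite expr0 scale1r.
have step (h : tfree R B -> W) : linear h -> h u =
    \sum_(k <- msupp (u 0)) fpsC (u 0)@_k *: h (tbasis k) + alpha *: h (divalpha u).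
  move=> lh.
  pose H := HB.pack_for {linear tfree R B -> W} h (GRing.isLinear.Build _ _ _ _ h lh).
  rewrite -[h]/(H : _ -> _) {1}[u]tfree_decomp linearD linear_sum linearZ.
  by congr (_ + _); apply: eq_bigr => k _; rewrite linearZ.
have -> : f u - g u = alpha *: (f (divalpha u) - g (divalpha u)).
  rewrite (step f) // (step g) // scalerBr.
  by under eq_bigr do rewrite fg; rewrite opprD addrACA subrr add0r.
exact: (adiv_alpha 1 (IH _)).
Qed.

Section Operators.

(* X = exp (alpha L): the factor alpha is carried by expc. *)
Definition opexp (W : lmodType (fps R)) (L X : W -> W) :=
  forall n w, adiv n (X w - \sum_(i < n) expc i *: iter i L w).

(** phi commutes with every partial sum of the exponential series, and the remainders are divisible
    by arbitrarily high powers of alpha. *)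
Lemma opexp_intertwine (V W : lmodType (fps R)) (LV XV : V -> V) (LW XW : W -> W)
    (phi : {linear V -> W}) :
  adic_separated W -> opexp LV XV -> opexp LW XW ->
  (forall v, phi (LV v) = LW (phi v)) -> forall v, phi (XV v) = XW (phi v).
Proof.
move=> sep eV eW comm v; apply: separated_eq => // n.
have commi i : phi (iter i LV v) = iter i LW (phi v).
  by elim: i => //= i IH; rewrite comm IH.
have -> : phi (XV v) - XW (phi v) =
    phi (XV v - \sum_(i < n) expc i *: iter i LV v) -
    (XW (phi v) - \sum_(i < n) expc i *: iter i LW (phi v)).
  rewrite linearB linear_sum /=.
  by under eq_bigr do rewrite linearZ /= commi; rewrite opprB addrA subrK.
by apply: adivB => //; apply: adiv_linear.
Qed.

(* The tails of the exponential series satisfy g n = L^n / n! + alpha g n.+1. *)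
Lemma opexp_exists (B : choiceType) (L : {linear tfree R B -> tfree R B}) :
  exists X : {linear tfree R B -> tfree R B}, opexp L X.
Proof.
have iterP n a x y : iter n L (a *: x + y) = a *: iter n L x + iter n L y.
  by elim: n => //= n ->; rewrite linearP.
pose c n : fps R := fpsC (n`!%:R)^-1.
(* [g n] sums alpha ^+ i L^(n + i) / (n + i)! over all i; in the coefficient of order m only the
   terms i <= m contribute, since the i-th is a multiple of alpha ^+ i. *)
pose g n (b : B) : tfree R B :=
  fun m => \sum_(i < m.+1) (alpha ^+ i *: (c (n + i)%N *: iter (n + i) L (tbasis b))) m.
have gS n b : g n b = c n *: iter n L (tbasis b) + alpha *: g n.+1 b.
  apply/funext => m; rewrite tfreeDE /g big_ord_recl /= expr0 scale1r addn0.
  congr (_ + _); rewrite alphaZ; case: m => [|m]; first by rewrite big_ord0.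
  by apply: eq_bigr => i _; rewrite exprS -scalerA alphaZ addnS addSn.
have GS n v : tlin (g n) v = c n *: iter n L v + alpha *: tlin (g n.+1) v.
  apply: (tlin_ext (g := fun v => c n *: iter n L v + alpha *: tlin (g n.+1) v)) => [a x y|a x y|b].
  - exact: tlinP.
  - by rewrite iterP tlinP !scalerDr !scalerA addrACA (mulrC (c n)) (mulrC alpha).
  - by rewrite !tlin_basis gS.
(* The remainder after n terms is alpha ^+ n times the n-th tail. *)
exists (tlin (g 0)) => n v; exists (tlin (g n) v).
suff tE : tlin (g 0) v = \sum_(i < n) expc i *: iter i L v + alpha ^+ n *: tlin (g n) v.
  by apply/eqP; rewrite subr_eq addrC; apply/eqP.
elim: n => [|n IH]; first by rewrite big_ord0 add0r expr0 scale1r.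
rewrite IH GS big_ord_recr /= (exprSr alpha n).
by rewrite scalerDr -!scalerA addrA.
Qed.

End Operators.
End Adic.
Arguments expc {R} i.

(** * Representations of the relations *)

Section Representations.
Variable R : numFieldType.

(** The relations are multiplied by alpha or 2 alpha wherever they contain a quotient, and [K, M] is
    replaced by [K, M + P0]. Operators on a module cover both the model, where no product exists
    yet, and algebras acting on themselves by left multiplication. *)
Record urep (W : lmodType (fps R)) := URep {
  opM : {linear W -> W};
  op0 : {linear W -> W};
  op1 : {linear W -> W};
  opK : {linear W -> W};
  opE : {linear W -> W};
  opE' : {linear W -> W};
  op0M : forall w, op0 (opM w) = opM (op0 w);
  op1M : forall w, op1 (opM w) = opM (op1 w);
  op10 : forall w, op1 (op0 w) = op0 (op1 w);
  opE_exp : opexp op1 opE;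
  opE'_exp : opexp (fun w => - op1 w) opE';
  opK0 : forall w, alpha *: (opK (op0 w) - op0 (opK w)) = opE w - w;
  opK1 : forall w, opK (op1 w) - op1 (opK w) = opM (opE w) + op0 (opE w);
  opKN : forall w,
    (alpha *+ 2) *: (opK (opM w + op0 w) - (opM (opK w) + op0 (opK w))) =
    opE w - opE' w - alpha ^+ 2 *:
      (opM (opM (opE w) + op0 (opE w)) + op0 (opM (opE w) + op0 (opE w)))
}.

Definition pbw_op (W : lmodType (fps R)) (r : urep W) (t : pbw) (w : W) : W :=
  let: (a, b, c, d) := t in
  iter a (opM r) (iter b (op0 r) (iter c (op1 r) (iter d (opK r) w))).

Lemma iter_comm T (f g : T -> T) n x :
  (forall x, f (g x) = g (f x)) -> f (iter n g x) = iter n g (f x).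
Proof. by move=> fg; elim: n => //= n IH; rewrite fg IH. Qed.

Section Intertwine.
Variables (W : lmodType (fps R)) (rV : urep (tfree R pbw)) (rW : urep W).
Variables (v0 : tfree R pbw) (w0 : W) (phi : {linear tfree R pbw -> W}).
Hypothesis sep : adic_separated W.
Hypothesis rV_basis : forall t, pbw_op rV t v0 = tbasis t.
Hypothesis phi_basis : forall t, phi (tbasis t) = pbw_op rW t w0.

Let phiM v : phi (opM rV v) = opM rW (phi v).
Proof.
apply: (tfree_ext (f := fun v => phi (opM rV v)) (g := fun v => opM rW (phi v)))
  => // [x y z|x y z|[[[a b] c] d]].
- by rewrite !linearP.
- by rewrite !linearP.
by rewrite -rV_basis [in LHS]/= -[LHS]/(phi (pbw_op rV (a.+1, b, c, d) v0)) !rV_basis !phi_basis.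
Qed.

Let phi0 v : phi (op0 rV v) = op0 rW (phi v).
Proof.
apply: (tfree_ext (f := fun v => phi (op0 rV v)) (g := fun v => op0 rW (phi v)))
  => // [x y z|x y z|[[[a b] c] d]].
- by rewrite !linearP.
- by rewrite !linearP.
rewrite phi_basis -rV_basis /= (iter_comm _ _ (op0M rV)).
rewrite -[X in phi X]/(pbw_op rV (a, b.+1, c, d) v0) rV_basis phi_basis /=.
by rewrite (iter_comm _ _ (op0M rW)).
Qed.

Let phi1 v : phi (op1 rV v) = op1 rW (phi v).
Proof.
apply: (tfree_ext (f := fun v => phi (op1 rV v)) (g := fun v => op1 rW (phi v)))
  => // [x y z|x y z|[[[a b] c] d]].
- by rewrite !linearP.
- by rewrite !linearP.
rewrite phi_basis -rV_basis /= (iter_comm _ _ (op1M rV)) (iter_comm _ _ (op10 rV)).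
rewrite -[X in phi X]/(pbw_op rV (a, b, c.+1, d) v0) rV_basis phi_basis /=.
by rewrite (iter_comm _ _ (op1M rW)) (iter_comm _ _ (op10 rW)).
Qed.

Lemma intertwineE v : phi (opE rV v) = opE rW (phi v).
Proof. exact: (opexp_intertwine sep (opE_exp rV) (opE_exp rW)). Qed.

Let phiE' v : phi (opE' rV v) = opE' rW (phi v).
Proof.
apply: (opexp_intertwine sep (opE'_exp rV) (opE'_exp rW)) => w.
by rewrite linearN phi1.
Qed.

(** K stands innermost in a monomial and has to be moved past M, P0 and P1. Its commutators with
    them are expressed by operators already known to be intertwined, so the property passes from w
    to X w for each such X, starting from the vectors K^d v0. *)
Let phiK v : phi (opK rV v) = opK rW (phi v).
Proof.
have phiZ a x : phi (a *: x) = a *: phi x by rewrite linearZ.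
(* The relation only gives alpha times the commutator; torsion-freeness of W cancels alpha. *)
have c0 w : phi (opK rV (op0 rV w) - op0 rV (opK rV w)) =
            opK rW (op0 rW (phi w)) - op0 rW (opK rW (phi w)).
  by apply: alpha_inj; rewrite // -linearZ !opK0 linearB intertwineE.
have c1 w : phi (opK rV (op1 rV w) - op1 rV (opK rV w)) =
            opK rW (op1 rW (phi w)) - op1 rW (opK rW (phi w)).
  by rewrite !opK1 linearD phiM phi0 intertwineE.
have cN w : phi (opK rV (opM rV w + op0 rV w) - (opM rV (opK rV w) + op0 rV (opK rV w))) =
    opK rW (opM rW (phi w) + op0 rW (phi w)) - (opM rW (opK rW (phi w)) + op0 rW (opK rW (phi w))).
  apply: double_inj; apply: alpha_inj; rewrite // -!scalerMnr !scalerMnl opKN -linearZ opKN.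
  by rewrite !(linearB phi, phiZ, linearD phi, phiM, phi0, intertwineE, phiE').
(* [K, M] is recovered as [K, M + P0] - [K, P0]. *)
have cM w : phi (opK rV (opM rV w) - opM rV (opK rV w)) =
            opK rW (opM rW (phi w)) - opM rW (opK rW (phi w)).
  have split4 (U : zmodType) (x y z t : U) : x + y - (z + t) = (x - z) + (y - t).
    by rewrite opprD addrACA.
  have := cN w; rewrite (linearD (opK rV)) (linearD (opK rW)) !split4 (linearD phi) c0.
  by move/addIr.
apply: (tfree_ext (f := fun v => phi (opK rV v)) (g := fun v => opK rW (phi v)))
  => // [x y z|x y z|t].
- by rewrite !linearP.
- by rewrite !linearP.
have ind (L : tfree R pbw -> tfree R pbw) (L' : W -> W) n w :
    (forall w, phi (L w) = L' (phi w)) ->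
    (forall w, phi (opK rV (L w) - L (opK rV w)) =
       opK rW (L' (phi w)) - L' (opK rW (phi w))) ->
    phi (opK rV w) = opK rW (phi w) ->
    phi (opK rV (iter n L w)) = opK rW (phi (iter n L w)).
  move=> LL cL Kw; elim: n => //= n IH.
  by rewrite -[LHS](subrK (phi (L (opK rV (iter n L w))))) -linearB cL LL IH LL subrK.
case: t => [[[a b] c] d]; rewrite -rV_basis /=.
apply: (ind _ (opM rW)) => //; apply: (ind _ (op0 rW)) => //; apply: (ind _ (op1 rW)) => //.
(* On K^d v0 the operator K yields the next monomial K^(d+1) v0, whose image is prescribed. *)
rewrite -[iter d _ _]/(pbw_op rV (0, 0, 0, d)%N v0).
rewrite -[opK rV (pbw_op _ _ _)]/(pbw_op rV (0, 0, 0, d.+1)%N v0).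
by rewrite !rV_basis !phi_basis.
Qed.

(** Used twice: with phi the right multiplication by a fixed element it gives associativity of the
    model, and with phi the linear extension of a choice of images it gives multiplicativity in the
    universal property. *)
Lemma intertwine t v : phi (pbw_op rV t v) = pbw_op rW t (phi v).
Proof.
case: t => [[[a b] c] d] /=.
have it (L : tfree R pbw -> tfree R pbw) (L' : W -> W) n w :
    (forall w, phi (L w) = L' (phi w)) -> phi (iter n L w) = iter n L' (phi w).
  by move=> LL; elim: n => //= n IH; rewrite LL IH.
by rewrite !(it (opM rV) (opM rW), it (op0 rV) (op0 rW), it (op1 rV) (op1 rW),
  it (opK rV) (opK rW)).
Qed.

End Intertwine.
End Representations.

(** * The operator model *)

Section Model.
Variable R : numFieldType.

(** Needed to form operators such as (E - 1) / alpha: the quotient is taken on basis vectors and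
    extended linearly. *)
Lemma linear_divalpha (B : choiceType) (F : {linear tfree R B -> tfree R B}) :
  (forall v, adiv 1 (F v)) ->
  exists G : {linear tfree R B -> tfree R B}, forall v, alpha *: G v = F v.
Proof.
move=> F1; pose G : {linear tfree R B -> tfree R B} := tlin (fun k => divalpha (F (tbasis k))).
exists G; apply: (tfree_ext (f := fun v => alpha *: G v)) => [|a x y|a x y|k].
- exact: tfree_separated.
- by rewrite linearP scalerDr !scalerA mulrC.
- by rewrite linearP.
rewrite [G _]tlin_basis; apply/funext => -[|n]; rewrite alphaZ //.
by rewrite (adiv_tfree (F1 _)).
Qed.

(** * K as a shift plus a derivation, over commuting shifts *)

Section Weyl.
Variable V : lmodType (fps R).
Hypothesis sepV : adic_separated V.
Hypothesis expV : forall L : {linear V -> V}, exists X : {linear V -> V}, opexp L X.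
Hypothesis divV : forall F : {linear V -> V}, (forall v, adiv 1 (F v)) ->
  exists G : {linear V -> V}, forall v, alpha *: G v = F v.
Variables shiftM shift0 shift1 shiftK dM d0 d1 : {linear V -> V}.
Hypothesis shift0M : forall v, shift0 (shiftM v) = shiftM (shift0 v).
Hypothesis shift1M : forall v, shift1 (shiftM v) = shiftM (shift1 v).
Hypothesis shift10 : forall v, shift1 (shift0 v) = shift0 (shift1 v).
Hypothesis shiftKM : forall v, shiftK (shiftM v) = shiftM (shiftK v).
Hypothesis shiftK0 : forall v, shiftK (shift0 v) = shift0 (shiftK v).
Hypothesis shiftK1 : forall v, shiftK (shift1 v) = shift1 (shiftK v).
Hypothesis dMM : forall v, dM (shiftM v) = shiftM (dM v) + v.
Hypothesis dM0 : forall v, dM (shift0 v) = shift0 (dM v).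
Hypothesis dM1 : forall v, dM (shift1 v) = shift1 (dM v).
Hypothesis d0M : forall v, d0 (shiftM v) = shiftM (d0 v).
Hypothesis d00 : forall v, d0 (shift0 v) = shift0 (d0 v) + v.
Hypothesis d01 : forall v, d0 (shift1 v) = shift1 (d0 v).
Hypothesis d1M : forall v, d1 (shiftM v) = shiftM (d1 v).
Hypothesis d10 : forall v, d1 (shift0 v) = shift0 (d1 v).
Hypothesis d11 : forall v, d1 (shift1 v) = shift1 (d1 v) + v.

(** K is [shiftK] + RM dM + R0 d0 + R1 d1, where RM, R0, R1 are the prescribed values of [K, M],
    [K, P0], [K, P1]. These are functions of the commuting shifts, and [dX, X] = 1, so [K, X] = RX.
    The last clause, where the derivation part vanishes, serves to obtain the PBW basis. *)
Lemma urep_weyl : exists2 r : urep V,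
  [/\ opM r = shiftM, op0 r = shift0 & op1 r = shift1] &
  forall v, dM v = 0 -> d0 v = 0 -> d1 v = 0 -> opK r v = shiftK v.
Proof.
have [X Xexp] := expV shift1.
have [X' X'exp] := expV (\- shift1 : {linear V -> V}).
have commX (f : {linear V -> V}) : (forall v, f (shift1 v) = shift1 (f v)) ->
    forall v, f (X v) = X (f v).
  by move=> f1; apply: (opexp_intertwine sepV Xexp Xexp).
have commX' (f : {linear V -> V}) : (forall v, f (shift1 v) = shift1 (f v)) ->
    forall v, f (X' v) = X' (f v).
  by move=> f1; apply: (opexp_intertwine sepV X'exp X'exp) => v; rewrite /= linearN f1.
have X1 v : adiv 1 (X v - v).
  by have := Xexp 1 v; rewrite big_ord1 expc0 scale1r.
have X'1 v : adiv 1 (X' v - v).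
  by have := X'exp 1 v; rewrite big_ord1 expc0 scale1r.
have [N NE] : exists N : {linear V -> V}, forall v, N v = shiftM v + shift0 v.
  by exists (shiftM \+ shift0).
have [R0 R0E] : exists G : {linear V -> V}, forall v, alpha *: G v = X v - v.
  exact: (divV (F := X \- idfun)).
(* RN is (E - E' - alpha^2 N^2 E) / (2 alpha), the value of [K, N]; the division is possible because
   E and E' are both 1 modulo alpha. *)
have [RN RNE] : exists G : {linear V -> V}, forall v, alpha *: G v =
    fpsC 2^-1 *: (X v - X' v - alpha ^+ 2 *: N (N (X v))).
  apply: (divV
    (F := fpsC 2^-1 \*: (X \- X' \- (alpha ^+ 2 \*: (N \o N \o X))))) => v.
  rewrite /=; apply: adivZ; apply: adivB.
    have -> : X v - X' v = (X v - v) - (X' v - v) by rewrite opprB addrA subrK.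
    exact: adivB.
  by apply: (adiv_leq (n := 2)) => //; exists (N (N (X v))).
(* Commutation with a quotient by alpha is checked after multiplying by alpha. *)
have commG (f G : {linear V -> V}) F : (forall v, alpha *: G v = F v) ->
    (forall v, f (F v) = F (f v)) -> forall v, G (f v) = f (G v).
  move=> GF fF v; apply: alpha_inj; rewrite // GF -fF -GF.
  by rewrite (linearZ_LR f).
have R0c (f : {linear V -> V}) : (forall v, f (shift1 v) = shift1 (f v)) ->
    forall v, R0 (f v) = f (R0 v).
  by move=> f1; apply: (commG _ _ _ R0E) => // v; rewrite (linearB f) (commX f f1).
have RNc (f : {linear V -> V}) : (forall v, f (shift1 v) = shift1 (f v)) ->
    (forall v, f (N v) = N (f v)) -> forall v, RN (f v) = f (RN v).
  move=> f1 fN v; apply: (commG _ _ _ RNE) => // {}v.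
  by rewrite (linearZ_LR f) (linearB f) (linearB f) (linearZ_LR f) !fN (commX f f1) (commX' f f1).
have [R1 R1E] : exists R1 : {linear V -> V}, forall v, R1 v = N (X v).
  by exists (N \o X).
have R1c (f : {linear V -> V}) : (forall v, f (shift1 v) = shift1 (f v)) ->
    (forall v, f (N v) = N (f v)) -> forall v, R1 (f v) = f (R1 v).
  by move=> f1 fN v; rewrite !R1E -(commX f f1) fN.
have NM v : shiftM (N v) = N (shiftM v) by rewrite !NE linearD shift0M.
have N0 v : shift0 (N v) = N (shift0 v) by rewrite !NE linearD shift0M.
have N1 v : shift1 (N v) = N (shift1 v) by rewrite !NE linearD shift1M shift10.
(* Again [K, M] = [K, N] - [K, P0]. *)
have [RM RME] : exists RM : {linear V -> V}, forall v, RM v = RN v - R0 v.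
  by exists (RN \- R0).
have [K KE] : exists K : {linear V -> V},
    forall v, K v = shiftK v + RM (dM v) + R0 (d0 v) + R1 (d1 v).
  by exists (shiftK \+ (RM \o dM) \+ (R0 \o d0) \+ (R1 \o d1)).
have RMc (f : {linear V -> V}) : (forall v, f (shift1 v) = shift1 (f v)) ->
    (forall v, f (N v) = N (f v)) -> forall v, RM (f v) = f (RM v).
  by move=> f1 fN v; rewrite !RME (RNc f f1 fN) (R0c f f1) (linearB f).
have s1M v : shiftM (shift1 v) = shift1 (shiftM v) by rewrite shift1M.
have s10 v : shift0 (shift1 v) = shift1 (shift0 v) by rewrite shift10.
have KM v : K (shiftM v) = shiftM (K v) + RM v.
  rewrite !KE shiftKM dMM d0M d1M linearD !(RMc _ s1M, R0c _ s1M, R1c _ s1M) //.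
  by rewrite !(linearD shiftM) -!addrA; do 2!congr (_ + _); rewrite addrC -addrA.
have K0 v : K (shift0 v) = shift0 (K v) + R0 v.
  rewrite !KE shiftK0 dM0 d00 d10 linearD !(RMc _ s10, R0c _ s10, R1c _ s10) //.
  by rewrite !(linearD shift0) -!addrA; do 3!congr (_ + _); rewrite addrC.
have K1 v : K (shift1 v) = shift1 (K v) + R1 v.
  rewrite !KE shiftK1 dM1 d01 d11 linearD
    !(RMc _ (fun _ => erefl), R0c shift1 (fun _ => erefl), R1c shift1 (fun _ => erefl)) //.
  by rewrite !(linearD shift1) -!addrA.
have opK0 w : alpha *: (K (shift0 w) - shift0 (K w)) = X w - w.
  by rewrite K0 addrC addKr R0E.
have opK1 w : K (shift1 w) - shift1 (K w) = shiftM (X w) + shift0 (X w).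
  by rewrite K1 addrC addKr R1E NE.
have opKN w : (alpha *+ 2) *: (K (shiftM w + shift0 w) - (shiftM (K w) + shift0 (K w))) =
    X w - X' w - alpha ^+ 2 *:
      (shiftM (shiftM (X w) + shift0 (X w)) + shift0 (shiftM (X w) + shift0 (X w))).
  have -> : K (shiftM w + shift0 w) - (shiftM (K w) + shift0 (K w)) = RN w.
    rewrite (linearD K) KM K0 addrACA [X in X - _]addrC addrK RME.
    by rewrite subrK.
  rewrite -scalerMnl RNE double_half.
  by rewrite -!NE.
exists (URep shift0M shift1M shift10 Xexp X'exp opK0 opK1 opKN) => // v dv0 dv1 dv2.
by rewrite /= KE dv0 dv1 dv2 !linear0 !addr0.
Qed.

End Weyl.

Notation V := (tfree R pbw).

Lemma endo_ext (f g : V -> V) : linear f -> linear g ->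
  (forall a b c d, f (tbasis ((a, b, c, d) : pbw)) = g (tbasis ((a, b, c, d) : pbw))) ->
  f =1 g.
Proof.
by move=> lf lg fg; apply: tfree_ext => // [|[[[a b] c] d]]; [exact: tfree_separated|exact: fg].
Qed.

Section Shifts.
Variables shiftM shift0 shift1 shiftK dM d0 d1 : {linear V -> V}.
Hypothesis shiftM_b : forall a b c d : nat,
  shiftM (tbasis ((a, b, c, d) : pbw)) = tbasis ((a.+1, b, c, d) : pbw).
Hypothesis shift0_b : forall a b c d : nat,
  shift0 (tbasis ((a, b, c, d) : pbw)) = tbasis ((a, b.+1, c, d) : pbw).
Hypothesis shift1_b : forall a b c d : nat,
  shift1 (tbasis ((a, b, c, d) : pbw)) = tbasis ((a, b, c.+1, d) : pbw).
Hypothesis shiftK_b : forall a b c d : nat,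
  shiftK (tbasis ((a, b, c, d) : pbw)) = tbasis ((a, b, c, d.+1) : pbw).
Hypothesis dM_b : forall a b c d : nat,
  dM (tbasis ((a, b, c, d) : pbw)) = tbasis ((a.-1, b, c, d) : pbw) *+ a.
Hypothesis d0_b : forall a b c d : nat,
  d0 (tbasis ((a, b, c, d) : pbw)) = tbasis ((a, b.-1, c, d) : pbw) *+ b.
Hypothesis d1_b : forall a b c d : nat,
  d1 (tbasis ((a, b, c, d) : pbw)) = tbasis ((a, b, c.-1, d) : pbw) *+ c.

Let basisE := (shiftM_b, shift0_b, shift1_b, shiftK_b, dM_b, d0_b, d1_b).

Local Ltac by_basis := apply: endo_ext;
  [by move=> x u v; rewrite !linearP
  |by move=> x u v; rewrite !linearP
  |by move=> a b c d; rewrite ?(linearMn, basisE)].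

Lemma shift0M v : shift0 (shiftM v) = shiftM (shift0 v).
Proof. by move: v; by_basis. Qed.
Lemma shift1M v : shift1 (shiftM v) = shiftM (shift1 v).
Proof. by move: v; by_basis. Qed.
Lemma shift10 v : shift1 (shift0 v) = shift0 (shift1 v).
Proof. by move: v; by_basis. Qed.
Lemma shiftKM v : shiftK (shiftM v) = shiftM (shiftK v).
Proof. by move: v; by_basis. Qed.
Lemma shiftK0 v : shiftK (shift0 v) = shift0 (shiftK v).
Proof. by move: v; by_basis. Qed.
Lemma shiftK1 v : shiftK (shift1 v) = shift1 (shiftK v).
Proof. by move: v; by_basis. Qed.
Lemma dM0 v : dM (shift0 v) = shift0 (dM v).
Proof. by move: v; by_basis. Qed.
Lemma dM1 v : dM (shift1 v) = shift1 (dM v).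
Proof. by move: v; by_basis. Qed.
Lemma d0M v : d0 (shiftM v) = shiftM (d0 v).
Proof. by move: v; by_basis. Qed.
Lemma d01 v : d0 (shift1 v) = shift1 (d0 v).
Proof. by move: v; by_basis. Qed.
Lemma d1M v : d1 (shiftM v) = shiftM (d1 v).
Proof. by move: v; by_basis. Qed.
Lemma d10 v : d1 (shift0 v) = shift0 (d1 v).
Proof. by move: v; by_basis. Qed.
Local Ltac by_weyl := apply: endo_ext;
  [by move=> x u v; rewrite !linearP
  |by move=> x u v; rewrite !linearP scalerDr addrACA
  |move=> [|a] [|b] [|c] d;rewrite ?(linearMn, basisE, mulr0n, mulr1n, add0r) //= ?mulrSr].
Lemma dMM v : dM (shiftM v) = shiftM (dM v) + v.
Proof. by move: v; by_weyl. Qed.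
Lemma d00 v : d0 (shift0 v) = shift0 (d0 v) + v.
Proof. by move: v; by_weyl. Qed.
Lemma d11 v : d1 (shift1 v) = shift1 (d1 v) + v.
Proof. by move: v; by_weyl. Qed.

Lemma urep_shifts :
  exists r : urep V, forall t, pbw_op r t (tbasis ((0, 0, 0, 0)%N : pbw)) = tbasis t.
Proof.
have [r [rM r0 r1] rK] := urep_weyl (@tfree_separated R pbw) (@opexp_exists R pbw)
  (@linear_divalpha pbw) shift0M shift1M shift10 shiftKM shiftK0 shiftK1
  dMM dM0 dM1 d0M d00 d01 d1M d10 d11.
exists r => -[[[a b] c] d]; rewrite /= rM r0 r1.
(* The monomials K^d contain no M, P0 or P1, so the derivation part of K kills them. *)
have -> : iter d (opK r) (tbasis ((0, 0, 0, 0)%N : pbw)) = tbasis ((0, 0, 0, d)%N : pbw).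
  by elim: d => //= d ->; rewrite rK ?dM_b ?d0_b ?d1_b ?mulr0n // shiftK_b.
have -> : iter c shift1 (tbasis ((0, 0, 0, d)%N : pbw)) = tbasis ((0, 0, c, d)%N : pbw).
  by elim: c => //= c ->; rewrite shift1_b.
have -> : iter b shift0 (tbasis ((0, 0, c, d)%N : pbw)) = tbasis ((0, b, c, d)%N : pbw).
  by elim: b => //= b ->; rewrite shift0_b.
by elim: a => //= a ->; rewrite shiftM_b.
Qed.

End Shifts.

Lemma urep_model :
  exists r : urep V, forall t, pbw_op r t (tbasis ((0, 0, 0, 0)%N : pbw)) = tbasis t.
Proof.
have lin (f : nat -> nat -> nat -> nat -> V) : exists L : {linear V -> V},
    forall a b c d : nat, L (tbasis ((a, b, c, d) : pbw)) = f a b c d.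
  exists (tlin (fun t : pbw => let: (a, b, c, d) := t in f a b c d)) => a b c d.
  exact: tlin_basis.
have [shiftM shiftM_b] := lin (fun a b c d => tbasis ((a.+1, b, c, d) : pbw)).
have [shift0 shift0_b] := lin (fun a b c d => tbasis ((a, b.+1, c, d) : pbw)).
have [shift1 shift1_b] := lin (fun a b c d => tbasis ((a, b, c.+1, d) : pbw)).
have [shiftK shiftK_b] := lin (fun a b c d => tbasis ((a, b, c, d.+1) : pbw)).
(* For a = 0 the multiplicity 0 makes the truncated predecessor harmless; likewise for [d0] and
   [d1]. *)
have [dM dM_b] := lin (fun a b c d => tbasis ((a.-1, b, c, d) : pbw) *+ a).
have [d0 d0_b] := lin (fun a b c d => tbasis ((a, b.-1, c, d) : pbw) *+ b).
have [d1 d1_b] := lin (fun a b c d => tbasis ((a, b, c.-1, d) : pbw) *+ c).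
exact: (urep_shifts shiftM_b shift0_b shift1_b shiftK_b dM_b d0_b d1_b).
Qed.

End Model.

(** * Exponentials in an algebra *)

Section Exponential.
Variable R : numFieldType.

(* e = exp (alpha y): the factor alpha is carried by expc. *)
Definition is_exp (T : algType (fps R)) (y e : T) :=
  forall n, adiv n (e - \sum_(i < n) expc i *: y ^+ i).

Lemma is_exp_unique (T : algType (fps R)) (y e f : T) :
  adic_separated T -> is_exp y e -> is_exp y f -> e = f.
Proof.
move=> sep ye yf; apply: separated_eq => // n.
have -> : e - f = (e - \sum_(i < n) expc i *: y ^+ i) - (f - \sum_(i < n) expc i *: y ^+ i).
  by rewrite opprB addrA subrK.
exact: adivB.
Qed.

Lemma iter_lmul (T : pzRingType) (y w : T) n : iter n ( *%R y) w = y ^+ n * w.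
Proof. by elim: n => [|n IH]; rewrite ?mul1r // iterS IH exprS mulrA. Qed.

Lemma is_exp_op (T : algType (fps R)) (y e : T) :
  is_exp y e -> opexp ( *%R y) ( *%R e).
Proof.
move=> ye n w; have [z ez] := ye n; exists (z * w).
by rewrite scalerAl -ez mulrBl mulr_suml; congr (_ - _); apply: eq_bigr => i _;
  rewrite iter_lmul scalerAl.
Qed.

Lemma opexp_is_exp (T : algType (fps R)) (y e : T) (L X : T -> T) :
  opexp L X -> (forall w, L w = y * w) -> is_exp y (X 1).
Proof.
move=> LX Ly n; have := LX n 1.
by under eq_bigr do rewrite (eq_iter Ly) iter_lmul mulr1.
Qed.

(** Links the coefficientwise sum [texp] to the congruences [is_exp]: at order m < n both series
    stop at i = m, because (alpha y) ^+ i has no coefficient below order i. *)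
Lemma texp_is_exp (B : choiceType) (A : talgebra R B) (y : A) :
  is_exp y (texp (alpha *: y)).
Proof.
move=> n; apply: tfree_adiv => m mn.
pose G i := (i`!%:R)^-1 *: (((alpha *: y) ^+ i : A) : tfree R B) m.
have G0 i : (m < i)%N -> G i = 0.
  move=> mi; rewrite /G exprZn (adiv_tfree _ mi) ?scaler0 //.
  by exists (y ^+ i : A).
have GE i : (expc i *: (y ^+ i : A) : tfree R B) m = G i.
  by rewrite /expc mulrC -scalerA fpsCZ /G exprZn.
have -> : (texp (alpha *: y) - \sum_(i < n) expc i *: (y ^+ i : A)) m =
    texp (alpha *: y) m - \sum_(i < n) G i.
  have sumE : (\sum_(i < n) expc i *: (y ^+ i : A) : tfree R B) m =
      \sum_(i < n) (expc i *: (y ^+ i : A) : tfree R B) m.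
    by rewrite fct_sumE.
  transitivity (texp (alpha *: y) m - (\sum_(i < n) expc i *: (y ^+ i : A) : tfree R B) m) => //.
  by rewrite sumE; congr (_ - _); apply: eq_bigr.
apply/eqP; rewrite subr_eq0; apply/eqP; transitivity (\sum_(i < m.+1) G i) => //.
rewrite (big_ord_widen n G mn) big_mkcond; apply: eq_bigr => i _.
by case: ltnP => // /G0.
Qed.


Section ExpTheory.
Variable T : algType (fps R).
Hypothesis sep : adic_separated T.
Implicit Types (x y z e f k : T).

Lemma adiv_mull n x y : adiv n x -> adiv n (y * x).
Proof. by move=> [z ->]; exists (y * z); rewrite scalerAr. Qed.

Lemma adiv_mulr n x y : adiv n x -> adiv n (x * y).
Proof. by move=> [z ->]; exists (z * y); rewrite scalerAl. Qed.

Lemma is_exp0 : is_exp (0 : T) 1.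
Proof.
move=> n; case: n => [|n]; 
  first by exists (1 - \sum_(i < 0) expc i *: 0 ^+ i); rewrite expr0 scale1r.
rewrite big_ord_recl expc0 scale1r big1 ?addr0 ?expr0 ?subrr => [|i _]; first exact: adiv0.
by rewrite exprS mul0r scaler0.
Qed.

Lemma is_exp_adiv1 y e : is_exp y e -> adiv 1 (e - 1).
Proof. by move=> /(_ 1); rewrite big_ord1 expc0 scale1r expr0. Qed.

Lemma is_exp_adiv2 y e : is_exp y e -> adiv 2 (e - 1 - alpha *: y).
Proof.
have c1 : expc 1 = alpha :> fps R by have := @expcS R 0; rewrite expc0 mulr1.
by move=> /(_ 2); rewrite big_ord_recl big_ord1 expc0 scale1r expr0 c1 opprD addrA.
Qed.

Lemma is_exp_comm x y e : is_exp y e -> GRing.comm x y -> GRing.comm x e.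
Proof.
move=> ye xy; apply: separated_eq => // n.
have -> : x * e - e * x = x * (e - \sum_(i < n) expc i *: y ^+ i) -
    (e - \sum_(i < n) expc i *: y ^+ i) * x.
  rewrite mulrBr mulrBl opprB addrA mulr_sumr mulr_suml.
  under eq_bigr => i _ do rewrite -scalerAr (commrX i xy) scalerAl.
  by rewrite subrK.
by apply: adivB; [apply: adiv_mull|apply: adiv_mulr].
Qed.

(** The partial sum for y + z regroups, by the binomial formula, into products of terms over the
    triangle i + j <= n; what remains is a combination of tails of e and of f. *)
Lemma is_expD y z e f :
  GRing.comm y z -> is_exp y e -> is_exp z f -> is_exp (y + z) (e * f).
Proof.
move=> yz ye zf n; case: n => [|n].
  by exists (e * f - \sum_(i < 0) expc i *: (y + z) ^+ i); rewrite expr0 scale1r.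
have -> : \sum_(i < n.+1) expc i *: (y + z) ^+ i =
    \sum_(i < n.+1) \sum_(j < (n - i).+1) (expc i *: y ^+ i) * (expc j *: z ^+ j).
  rewrite (sum_triangle (fun i j _ : nat => (expc i *: y ^+ i) * (expc j *: z ^+ j))).
  apply: eq_bigr => k _; rewrite addrC exprDn_comm; last exact: commr_sym.
  rewrite scaler_sumr; apply: eq_bigr => i _.
  have ik : (i <= k)%N by rewrite -ltnS.
  rewrite -scalerAl -scalerAr scalerA -expcM subnKC // -scalerMnl scalerMnr.
  by congr (_ *: (_ *+ _)); apply: commrX; apply/commr_sym/commrX.
(* The error is the tail of e times f, plus each term of e times the tail of f beyond degree n -
   i. *)
have -> : e * f - \sum_(i < n.+1) \sum_(j < (n - i).+1) (expc i *: y ^+ i) * (expc j *: z ^+ j)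
  = (e - \sum_(i < n.+1) expc i *: y ^+ i) * f +
    \sum_(i < n.+1) (expc i *: y ^+ i) * (f - \sum_(j < (n - i).+1) expc j *: z ^+ j).
  under [X in _ = _ + X]eq_bigr do rewrite mulrBr mulr_sumr.
  by rewrite sumrB mulrBl mulr_suml addrA subrK.
apply: adivD; first exact: adiv_mulr.
apply: adiv_sum => i _; rewrite /expc -scalerAl -scalerA.
have le_in : (i <= n)%N by rewrite -ltnS.
(* alpha ^+ i from the coefficient and alpha ^+ (n - i + 1) from the tail make up alpha ^+ (n +
   1). *)
apply: (adiv_leq (n := (i + (n - i).+1)%N)); first by rewrite addnS subnKC.
by apply: adiv_alpha; apply: adivZ; apply: adiv_mull.
Qed.

(** The bracket with k is a derivation, and since [k, y] commutes with y it acts on the exponential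
    series by the chain rule. *)
Lemma is_exp_bracket k y e : is_exp y e -> GRing.comm y (k * y - y * k) ->
  k * e - e * k = alpha *: ((k * y - y * k) * e).
Proof.
move=> ye yc; set c := k * y - y * k in yc *; apply: separated_eq => // n.
have powE i : k * y ^+ i.+1 - y ^+ i.+1 * k = (c * y ^+ i) *+ i.+1.
  elim: i => [|i IH]; first by rewrite expr1 expr0 mulr1.
  rewrite exprSr mulrA -[k * y ^+ i.+1](subrK (y ^+ i.+1 * k)) IH mulrDl.
  rewrite -addrA -!mulrA -mulrBr -/c mulrnAl -mulrA -exprSr.
  by rewrite (commrX _ (commr_sym yc)) [RHS]mulrSr.
(* One term fewer on the right: the derivation kills the constant term and lowers the degree, and
   the alpha it releases makes up for it. *)
have sumE : k * (\sum_(i < n.+1) expc i *: y ^+ i) - (\sum_(i < n.+1) expc i *: y ^+ i) * k =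
    alpha *: (c * \sum_(i < n) expc i *: y ^+ i).
  rewrite !mulr_sumr mulr_suml -sumrB big_ord_recl scaler_sumr.
  rewrite -scalerAl -scalerAr expr0 mulr1 mul1r subrr add0r; apply: eq_bigr => i _.
  rewrite -!scalerAr -!scalerAl -scalerBr powE -scalerMnr scalerMnl expcS.
  by rewrite scalerA.
clearbody c; set s := \sum_(i < n.+1) _ in sumE.
have -> : k * e - e * k - alpha *: (c * e) =
   (k * (e - s) - (e - s) * k)
   - alpha *: (c * (e - \sum_(i < n) expc i *: y ^+ i)).
  rewrite [c * (_ - _)]mulrBr scalerBr -sumE !(mulrBr, mulrBl).
  by apply: (addIr (alpha *: (c * e) - (k * s - s * k))); rewrite subrK addrA subrK !opprB
    addrACA [RHS]addrACA [- _ - k * s]addrC.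
apply: adivB; last by apply/adivZ/adiv_mull.
by apply: adivB; [apply: adiv_mull|apply: adiv_mulr]; apply: (adiv_leq (leqnSn n)).
Qed.

End ExpTheory.
End Exponential.

(** * The relations in an algebra *)

Section Relations.
Variable R : numFieldType.

Section Elements.
Variable T : algType (fps R).

(** The counterpart of [urep] for elements of an algebra. The exponentials e and e' are parameters
    characterised by [is_exp], because a general T has no coefficientwise [texp]. *)
Record urel (m p0 p1 k e e' : T) : Prop := URel {
  urel_0M : p0 * m = m * p0;
  urel_1M : p1 * m = m * p1;
  urel_10 : p1 * p0 = p0 * p1;
  urel_exp : is_exp p1 e;
  urel_exp' : is_exp (- p1) e';
  urel_K0 : alpha *: (k * p0 - p0 * k) = e - 1;
  urel_K1 : k * p1 - p1 * k = (m + p0) * e;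
  urel_KN : (alpha *+ 2) *: (k * (m + p0) - (m + p0) * k) =
    e - e' - alpha ^+ 2 *: ((m + p0) ^+ 2 * e)
}.

Lemma urel_rep m p0 p1 k e e' : urel m p0 p1 k e e' ->
  exists r : urep T, forall a b c d w,
    pbw_op r (a, b, c, d) w = m ^+ a * p0 ^+ b * p1 ^+ c * k ^+ d * w.
Proof.
move=> [c0M c1M c10 xe xe' K0 K1 KN].
pose mul (x : T) : {linear T -> T} := x \*o idfun.
have mulE x w : mul x w = x * w by [].
have eE : opexp (mul p1) (mul e) by apply: is_exp_op.
have eE' : opexp (fun w => - mul p1 w) (mul e').
  move=> n w; have := is_exp_op xe' n w.
  by under eq_bigr do rewrite (eq_iter (fun w => mulNr p1 w)).
have r0M w : mul p0 (mul m w) = mul m (mul p0 w) by rewrite !mulE !mulrA c0M.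
have r1M w : mul p1 (mul m w) = mul m (mul p1 w) by rewrite !mulE !mulrA c1M.
have r10 w : mul p1 (mul p0 w) = mul p0 (mul p1 w) by rewrite !mulE !mulrA c10.
have rK0 w : alpha *: (mul k (mul p0 w) - mul p0 (mul k w)) = mul e w - w.
  by rewrite !mulE !mulrA -mulrBl scalerAl K0 mulrBl mul1r.
have rK1 w : mul k (mul p1 w) - mul p1 (mul k w) = mul m (mul e w) + mul p0 (mul e w).
  by rewrite !mulE -mulrDl !mulrA -mulrBl K1.
have rKN w : (alpha *+ 2) *: (mul k (mul m w + mul p0 w) - (mul m (mul k w) + mul p0 (mul k w))) =
    mul e w - mul e' w - alpha ^+ 2 *:
      (mul m (mul m (mul e w) + mul p0 (mul e w)) + mul p0 (mul m (mul e w) + mul p0 (mul e w))).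
  rewrite !mulE -!mulrDl !mulrA -mulrBl scalerAl KN !mulrBl -scalerAl.
  by rewrite expr2 ?mulrA.
exists (URep r0M r1M r10 eE eE' rK0 rK1 rKN) => a b c d w /=.
by rewrite !iter_lmul !mulrA.
Qed.

(** Here h0 is (e - 1) / alpha and hM is (cosh (alpha p1) - 1) / alpha. The relations for [k, p0]
    and [k, m] are thus traded for their division-free form in terms of m + p0, and back, by
    cancelling 2 alpha. *)
Lemma urel_KM (m p0 k e e' h0 hM : T) :
  adic_separated T ->
  alpha *: h0 = e - 1 -> alpha *: hM = fpsC 2^-1 *: (e + e') - 1 ->
  (k * p0 - p0 * k = h0 /\
   k * m - m * k = - (hM + (alpha * fpsC 2^-1) *: ((m + p0) ^+ 2 * e))) <->
  (alpha *: (k * p0 - p0 * k) = e - 1 /\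
   (alpha *+ 2) *: (k * (m + p0) - (m + p0) * k) =
    e - e' - alpha ^+ 2 *: ((m + p0) ^+ 2 * e)).
Proof.
move=> sep h0E hME; set q := (m + p0) ^+ 2 * e.
have -> : k * (m + p0) - (m + p0) * k = (k * p0 - p0 * k) + (k * m - m * k).
  by rewrite mulrDr mulrDl opprD addrACA addrC.
(* The expected value of [k, m + p0]: the constants 1 cancel, and e - (e + e') / 2 is half of e -
   e'. *)
have key : (alpha *+ 2) *: (h0 - (hM + (alpha * fpsC 2^-1) *: q)) = e - e' - alpha ^+ 2 *: q.
  have a1 : alpha *: (h0 - (hM + (alpha * fpsC 2^-1) *: q)) =
      e - fpsC 2^-1 *: (e + e') - fpsC 2^-1 *: (alpha ^+ 2 *: q).
    rewrite scalerBr scalerDr h0E hME !scalerA mulrA -expr2 (mulrC (alpha ^+ 2)).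
    by rewrite opprD addrA opprB addrA subrK.
  by rewrite -scalerMnl a1 !mulrnBl !double_half mulr2n opprD addrACA subrr add0r.
split=> [[K0 KM]|[K0 KN]].
  by rewrite K0 KM key.
have K0' : k * p0 - p0 * k = h0 by apply: alpha_inj; rewrite // K0 h0E.
split=> //; apply: (addrI h0); apply: double_inj; apply: alpha_inj => //.
by rewrite -!scalerMnr !scalerMnl key -{1}K0' KN.
Qed.

Lemma is_exp_cosh_adiv1 (y z e f : T) :
  is_exp y e -> is_exp z f -> adiv 1 (fpsC 2^-1 *: (e + f) - 1).
Proof.
move=> ye zf; have -> : fpsC 2^-1 *: (e + f) - 1 = fpsC 2^-1 *: ((e - 1) + (f - 1)).
  rewrite addrACA -opprD -mulr2n scalerBr; congr (_ - _).
  by rewrite -scalerMnr double_half.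
by apply: adivZ; apply: adivD; [apply: is_exp_adiv1 ye|apply: is_exp_adiv1 zf].
Qed.

(** Both sides are exponentials of - p1 + p1 = 0, which is unique. *)
Lemma urel_E'E m p0 p1 k e e' :
  adic_separated T -> urel m p0 p1 k e e' -> e' * e = 1.
Proof.
move=> sep [_ _ _ xe xe' _ _ _]; apply: (is_exp_unique sep _ (is_exp0 _)).
by rewrite -(addNr p1); apply: is_expD => //; exact/commr_sym/commrN.
Qed.

End Elements.

Section Ualpha.
Variable A : talgebra R pbw.

(** Translates [divalpha] and [tcosh] into division-free relations. One direction verifies the
    model; the other feeds the universal property and the Hopf structure. *)
Lemma Ualpha_urel : Ualpha_algebra A <->
  (forall a b c d : nat, genM A ^+ a * genP0 A ^+ b * genP1 A ^+ c * genK A ^+ d =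
     (tbasis ((a, b, c, d) : pbw) : A)) /\ urel (genM A) (genP0 A) (genP1 A) (genK A)
    (texp (alpha *: genP1 A)) (texp (- (alpha *: genP1 A))).
Proof.
have sep : adic_separated A by exact: tfree_separated.
set M := genM A; set P0 := genP0 A; set P1 := genP1 A; set K := genK A.
have xE : is_exp P1 (texp (alpha *: P1)) by exact: texp_is_exp.
have xE' : is_exp (- P1) (texp (- (alpha *: P1))).
  by rewrite -scalerN; exact: texp_is_exp.
(* [divalpha] is a true quotient only on multiples of alpha; [E1] and [C1] supply the
   divisibility. *)
have divE (x : A) : adiv 1 x -> alpha *: (divalpha x : A) = x.
  move=> x1; apply/funext => -[|n]; rewrite [LHS]alphaZ //.
  by rewrite (adiv_tfree x1).
have E1 := is_exp_adiv1 xE.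
have C1 : adiv 1 (tcosh (alpha *: P1) - 1 : A).
  exact: (is_exp_cosh_adiv1 xE xE').
have KM := urel_KM M P0 K sep (divE _ E1) (divE _ C1).
split=> [[pbwA c01 cM0 cM1 K0 K1 K2]|[pbwA [c0M c1M c10 _ _ K0 K1 KN]]].
  have [K0' KN'] := KM.1 (conj K0 K2).
  split; first exact: pbwA.
  exact: (URel (esym (subr0_eq cM0)) (esym (subr0_eq cM1)) (esym (subr0_eq c01)) xE xE'
    K0' K1 KN').
have [K0' KM'] := KM.2 (conj K0 KN).
have comm_bracket (x y : A) : y * x = x * y -> tbracket x y = 0.
  by move=> yx; rewrite /tbracket yx subrr.
exact: (Build_Ualpha_algebra pbwA (comm_bracket _ _ c10) (comm_bracket _ _ c0M)
  (comm_bracket _ _ c1M) K0' K1 KM').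
Qed.

End Ualpha.
End Relations.

(** If the operators are left multiplications, evaluating their identities at 1 gives the relations
    between elements, with exponentials [opE r 1] and [opE' r 1]. *)
Lemma rep_urel (R : numFieldType) (T : algType (fps R)) (r : urep T) (m p0 p1 k : T) :
  (forall w, opM r w = m * w) -> (forall w, op0 r w = p0 * w) ->
  (forall w, op1 r w = p1 * w) -> (forall w, opK r w = k * w) ->
  urel m p0 p1 k (opE r 1) (opE' r 1).
Proof.
move=> rM r0 r1 rK; split.
- by have := op0M r 1; rewrite !(rM, r0) !mulr1.
- by have := op1M r 1; rewrite !(rM, r1) !mulr1.
- by have := op10 r 1; rewrite !(r0, r1) !mulr1.
- exact: opexp_is_exp (opE_exp r) r1.
- have rN1 w : - op1 r w = - p1 * w by rewrite r1 mulNr.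
  exact: opexp_is_exp (opE'_exp r) rN1.
- by have := opK0 r 1; rewrite !(rK, r0) !mulr1.
- by have := opK1 r 1; rewrite !(rK, r0, r1, rM) !mulr1 mulrDl.
by have := opKN r 1; rewrite !(rK, r0, rM) !mulr1 -!mulrDl expr2 -mulrA.
Qed.

(** * The product on the operator model *)

Section ModelAlgebra.
Variable R : numFieldType.
Notation V := (tfree R pbw).
Variable r : urep V.
Let one : V := tbasis ((0, 0, 0, 0)%N : pbw).
Hypothesis r_basis : forall t, pbw_op r t one = tbasis t.

Lemma pbw_op_linear (W : lmodType (fps R)) (s : urep W) t a x y :
  pbw_op s t (a *: x + y) = a *: pbw_op s t x + pbw_op s t y.
Proof.
have it (L : {linear W -> W}) n u v : iter n L (a *: u + v) = a *: iter n L u + iter n L v.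
  by elim: n => //= n ->; rewrite linearP.
by case: t => [[[i j] k] l]; rewrite /= !it.
Qed.

Definition model_mul (x y : V) : V := tlin (fun t => pbw_op r t y) x.

Fact model_mulPl a x x' y : model_mul (a *: x + x') y = a *: model_mul x y + model_mul x' y.
Proof. exact: tlinP. Qed.

Fact model_mulPr a x y y' : model_mul x (a *: y + y') = a *: model_mul x y + model_mul x y'.
Proof.
rewrite /model_mul -tlin_fun_linear; congr tlin.
by apply/funext => t; rewrite pbw_op_linear.
Qed.

Fact model_mul_basis t y : model_mul (tbasis t) y = pbw_op r t y.
Proof. exact: tlin_basis. Qed.

(** For x a basis monomial t the claim says that right multiplication by z commutes with the action
    of t. That map sends each monomial s to [pbw_op r s z], so [intertwine] applies. *)
Fact model_mulA : associative model_mul.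
Proof.
move=> x y z; apply: (tfree_ext (f := fun x => model_mul x (model_mul y z))
  (g := fun x => model_mul (model_mul x y) z)) => [|a u v|a u v|t].
- exact: tfree_separated.
- exact: model_mulPl.
- by rewrite !model_mulPl.
rewrite !model_mul_basis; symmetry.
apply: (intertwine (v0 := one) (w0 := z) (phi := tlin (fun t => pbw_op r t z))) => //.
- exact: tfree_separated.
- by move=> s; exact: tlin_basis.
Qed.

Fact model_mul1l : left_id one model_mul.
Proof. by move=> x; rewrite model_mul_basis. Qed.

Fact model_mul1r : right_id one model_mul.
Proof.
apply: (tfree_ext (f := fun x => model_mul x one) (g := fun x => x)) => [|a u v|a u v|t].
- exact: tfree_separated.
- exact: model_mulPl.
- by [].
by rewrite model_mul_basis r_basis.
Qed.

Definition model_algebra : talgebra R pbw :=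
  TAlgebra model_mulPl model_mulPr model_mulA model_mul1l model_mul1r (tbasis_neq0 R _).

Local Notation A := model_algebra.

Lemma model_Ualpha : Ualpha_algebra model_algebra.
Proof.
have sep : adic_separated V := @tfree_separated R pbw.
have ME (w : A) : genM A * w = opM r w by exact: model_mul_basis.
have P0E (w : A) : genP0 A * w = op0 r w by exact: model_mul_basis.
have P1E (w : A) : genP1 A * w = op1 r w by exact: model_mul_basis.
have KE (w : A) : genK A * w = opK r w by exact: model_mul_basis.
apply/Ualpha_urel; split.
  have powE (x : A) (L : V -> V) n (w : A) :
      (forall w : A, x * w = L w) -> x ^+ n * w = iter n L w.
    by move=> xL; rewrite -iter_lmul; elim: n => //= n ->; apply: xL.
  move=> a b c d; rewrite -r_basis /= -(powE _ _ d _ KE) -(powE _ _ c _ P1E).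
  by rewrite -(powE _ _ b _ P0E) -(powE _ _ a _ ME) mulr1 !mulrA.
have rel := rep_urel (r := (r : urep A)) (fun w => esym (ME w)) (fun w => esym (P0E w))
  (fun w => esym (P1E w)) (fun w => esym (KE w)).
(* Uniqueness of exponentials identifies [texp] with the operator exponential applied to 1. *)
have xE : texp (alpha *: genP1 A) = opE r (1 : A).
  exact: (is_exp_unique (sep : adic_separated A) (texp_is_exp _) (urel_exp rel)).
have xE' : texp (- (alpha *: genP1 A)) = opE' r (1 : A).
  rewrite -scalerN.
  exact: (is_exp_unique (sep : adic_separated A) (texp_is_exp _) (urel_exp' rel)).
by rewrite xE xE'; exact: rel.
Qed.

End ModelAlgebra.

Lemma Ualpha_exists (R : numFieldType) : exists A : talgebra R pbw, Ualpha_algebra A.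
Proof. by have [r rb] := urep_model R; exists (model_algebra rb); apply: model_Ualpha. Qed.

(** * Universal property *)

Section Universal.
Variables (R : numFieldType) (A : talgebra R pbw).
Hypothesis UA : Ualpha_algebra A.

Lemma basis000 : tbasis ((0, 0, 0, 0)%N : pbw) = 1 :> A.
Proof. by rewrite -(Ualpha_pbw UA) !expr0 !mulr1. Qed.

(** [intertwine], applied with the units of A and T as cyclic vectors, shows that f carries left
    multiplication by a monomial to left multiplication by its image. T is any separated algebra,
    including R[[alpha]] itself. *)
Lemma Ualpha_multiplicative (T : algType (fps R)) (m p0 p1 k e e' : T)
    (f : {linear A -> T}) :
  adic_separated T -> urel m p0 p1 k e e' ->
  (forall a b c d : nat, f (tbasis ((a, b, c, d) : pbw)) =
     m ^+ a * p0 ^+ b * p1 ^+ c * k ^+ d) ->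
  f 1 = 1 /\ forall x y, f (x * y) = f x * f y.
Proof.
move=> sep relT fb; split; first by rewrite -basis000 fb !expr0 !mulr1.
have [pbwA relA] := (Ualpha_urel A).1 UA.
have [r rE] := urel_rep relA; have [s sE] := urel_rep relT.
have fM t y : f ((tbasis t : A) * y) = f (tbasis t) * f y.
  have rt : (tbasis t : A) * y = pbw_op r t y.
    by case: t => [[[a b] c] d]; rewrite rE pbwA.
  have st : f (tbasis t) * f y = pbw_op s t (f y).
    by case: t {rt} => [[[a b] c] d]; rewrite fb sE.
  rewrite rt st; apply: (intertwine (v0 := (1 : A)) (w0 := 1)) => // -[[[a b] c] d].
    by rewrite rE pbwA mulr1.
  by rewrite sE mulr1 fb.
move=> x y; apply: (tfree_ext (f := fun x : A => f (x * y)) (g := fun x : A => f x * f y))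
  => [|a u v|a u v|t] //.
  by rewrite mulrDl -scalerAl linearP.
  by rewrite linearP mulrDl scalerAl.
exact: fM.
Qed.

Lemma lrmorphism_exists (S T : algType (fps R)) (f : S -> T) :
  linear f -> f 1 = 1 -> (forall x y, f (x * y) = f x * f y) ->
  exists g : {lrmorphism S -> T}, forall x, g x = f x.
Proof.
move=> lf f1 fM.
by exists (HB.pack_for {lrmorphism S -> T} f (GRing.isLinear.Build _ _ _ _ f lf)
  (GRing.isMonoidMorphism.Build _ _ f (conj f1 fM))).
Qed.

Lemma is_exp_morph (S T : algType (fps R)) (f : {lrmorphism S -> T}) y e :
  is_exp y e -> is_exp (f y) (f e).
Proof.
move=> ye n; have := adiv_linear f (ye n).
by rewrite linearB linear_sum /=; under eq_bigr do rewrite linearZ /= rmorphXn.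
Qed.

(** The values on the exponentials follow from uniqueness; they are recorded because the Hopf axioms
    on M and K involve the images of E and E'. *)
Lemma Ualpha_hom (C : choiceType) (T : talgebra R C) (m p0 p1 k e e' : T) :
  urel m p0 p1 k e e' -> exists f : {lrmorphism A -> T},
  [/\ f (genM A) = m, f (genP0 A) = p0, f (genP1 A) = p1, f (genK A) = k &
     f (texp (alpha *: genP1 A)) = e /\ f (texp (- (alpha *: genP1 A))) = e'].
Proof.
move=> relT.
pose g (t : pbw) : T := let: (a, b, c, d) := t in m ^+ a * p0 ^+ b * p1 ^+ c * k ^+ d.
have sep : adic_separated T by exact: tfree_separated.
have [pbwA relA] := (Ualpha_urel A).1 UA.
pose F : {linear A -> T} := tlin g.
have Fb (a b c d : nat) : F (tbasis ((a, b, c, d) : pbw)) = m ^+ a * p0 ^+ b * p1 ^+ c * k ^+ d.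
  exact: tlin_basis.
have [F1 FM] := Ualpha_multiplicative sep relT Fb.
have [f fE] := lrmorphism_exists (linearP F) F1 FM.
have fM : f (genM A) = m by rewrite fE (Fb 1 0 0 0)%N expr1 !expr0 !mulr1.
have f0 : f (genP0 A) = p0 by rewrite fE (Fb 0 1 0 0)%N expr1 !expr0 !mulr1 mul1r.
have f1 : f (genP1 A) = p1 by rewrite fE (Fb 0 0 1 0)%N expr1 !expr0 !mulr1 !mul1r.
have fK : f (genK A) = k by rewrite fE (Fb 0 0 0 1)%N expr1 !expr0 !mul1r.
exists f; apply: And5 => //; split.
  apply: (is_exp_unique sep _ (urel_exp relT)); rewrite -f1.
  exact: is_exp_morph (urel_exp relA).
apply: (is_exp_unique sep _ (urel_exp' relT)); rewrite -f1 -(rmorphN f).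
exact: is_exp_morph (urel_exp' relA).
Qed.

End Universal.

(** * The relations under the coproduct and the antipode *)

Section Bracket.
Variable T : pzRingType.
Implicit Types x y z : T.

Definition brack x y := x * y - y * x.

Lemma brackDl x y z : brack (x + y) z = brack x z + brack y z.
Proof. by rewrite /brack mulrDl mulrDr opprD addrACA. Qed.

Lemma brackDr x y z : brack x (y + z) = brack x y + brack x z.
Proof. by rewrite /brack mulrDl mulrDr opprD addrACA. Qed.

Lemma brackMl x y z : brack (x * y) z = x * brack y z + brack x z * y.
Proof. by rewrite /brack mulrBr mulrBl !mulrA addrA subrK. Qed.

Lemma brackMr x y z : brack x (y * z) = brack x y * z + y * brack x z.
Proof. by rewrite /brack mulrBr mulrBl !mulrA addrA subrK. Qed.

Lemma brack_comm x y : GRing.comm x y -> brack x y = 0.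
Proof. by move=> xy; rewrite /brack xy subrr. Qed.

Lemma brackN1 x : brack x (-1) = 0.
Proof. by rewrite /brack mulrN1 mulN1r subrr. Qed.

End Bracket.

Section Consequences.
Variables (R : numFieldType) (T : algType (fps R)) (m p0 p1 k e e' : T).
Hypothesis sep : adic_separated T.
Hypothesis rel : urel m p0 p1 k e e'.
Let n := m + p0.

Lemma urel_comm1 : [/\ GRing.comm p1 m, GRing.comm p1 p0 & GRing.comm p1 n].
Proof. by case: rel => _ c1M c10 _ _ _ _ _; split=> //; apply: commrD. Qed.

Lemma urel_comm_e x : GRing.comm x p1 -> GRing.comm x e /\ GRing.comm x e'.
Proof.
move=> x1; split; first exact: (is_exp_comm sep (urel_exp rel) x1).
exact: (is_exp_comm sep (urel_exp' rel) (commrN x1)).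
Qed.

Lemma urel_ee' : e * e' = 1.
Proof.
by rewrite -(urel_E'E sep rel); apply: (urel_comm_e _).2; apply/commr_sym/(urel_comm_e _).1.
Qed.

Lemma urel_Ke : k * e - e * k = alpha *: (n * e * e).
Proof.
rewrite (is_exp_bracket sep (urel_exp rel)) (urel_K1 rel) //.
have [_ _ c1n] := urel_comm1.
by apply: commrM => //; apply: (urel_comm_e _).1.
Qed.

(** Since [k, - p1] = - n e, the factor e' produced by the exponential cancels e. *)
Lemma urel_Ke' : k * e' - e' * k = - (alpha *: n).
Proof.
have K1 : k * - p1 - - p1 * k = - (n * e).
  by rewrite mulrN mulNr -opprD (urel_K1 rel).
rewrite (is_exp_bracket sep (urel_exp' rel)) K1.
  by rewrite mulNr -mulrA urel_ee' mulr1 scalerN.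
have [_ _ c1n] := urel_comm1.
apply/commrN/commr_sym/commrN/commr_sym/commrM => //; exact: (urel_comm_e _).1.
Qed.

End Consequences.

Section Coproduct.
Variables (R : numFieldType) (T T2 : algType (fps R)) (i1 i2 : {lrmorphism T -> T2}).
Hypothesis i12 : forall x y, i1 x * i2 y = i2 y * i1 x.
Variables (m p0 p1 k e e' : T).
Hypothesis sep : adic_separated T.
Hypothesis rel : urel m p0 p1 k e e'.
Let n := m + p0.
Let M := i1 m + i1 e' * i2 m + (i1 e' - 1) * i2 p0.
Let P0 := i1 p0 + i2 p0.
Let P1 := i1 p1 + i2 p1.
Let K := i1 k * i2 e + i2 k.

Let brack11 x y : brack (i1 x) (i1 y) = i1 (brack x y).
Proof. by rewrite /brack rmorphB !rmorphM. Qed.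
Let brack22 x y : brack (i2 x) (i2 y) = i2 (brack x y).
Proof. by rewrite /brack rmorphB !rmorphM. Qed.
Let brack12 x y : brack (i1 x) (i2 y) = 0.
Proof. by rewrite brack_comm. Qed.
Let brack21 x y : brack (i2 x) (i1 y) = 0.
Proof. by rewrite brack_comm // /GRing.comm i12. Qed.
Let brackE := (brackDl, brackDr, brackMl, brackMr, brack11, brack22, brack12, brack21,
  mul0r, mulr0, add0r, addr0).

Let i1Z (a : fps R) x : i1 (a *: x) = a *: i1 x.
Proof. exact: linearZ. Qed.
Let i2Z (a : fps R) x : i2 (a *: x) = a *: i2 x.
Proof. exact: linearZ. Qed.
Let i1B x y : i1 (x - y) = i1 x - i1 y.
Proof. exact: rmorphB. Qed.
Let i1N x : i1 (- x) = - i1 x.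
Proof. exact: rmorphN. Qed.
Let i2B x y : i2 (x - y) = i2 x - i2 y.
Proof. exact: rmorphB. Qed.

(* i1 x * i2 y stands for x (x) y. *)
Lemma urel_coproduct_N : M + P0 = i1 n + i1 e' * i2 n.
Proof.
rewrite /M /P0 /n !rmorphD mulrBl mul1r mulrDr -[LHS]addrA [_ - _ + _]addrACA addNr addr0.
by rewrite [i1 e' * _ + i1 p0]addrC addrACA.
Qed.

(** In each mixed product the single E' cancels E in the first factor, so both equal N (x) N E; in
    the last product one of the two E' survives. *)
Lemma urel_coproduct_sqr :
  (i1 n + i1 e' * i2 n) ^+ 2 * (i1 e * i2 e) =
  i1 (n ^+ 2 * e) * i2 e + (i1 n * i2 n * i2 e) *+ 2 + i1 e' * i2 (n ^+ 2 * e).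
Proof.
have [_ _ c1n] := urel_comm1 rel.
have ne' : i1 n * i1 e' = i1 e' * i1 n.
  by rewrite -!(rmorphM i1) (urel_comm_e sep rel (commr_sym c1n)).2.
have ne : i1 n * i1 e = i1 e * i1 n.
  by rewrite -!(rmorphM i1) (urel_comm_e sep rel (commr_sym c1n)).1.
have e'e : i1 e' * i1 e = 1 by rewrite -rmorphM (urel_E'E sep rel) rmorph1.
have e'xe (x : T) : i1 e' * i2 x * i1 e = i2 x.
  by rewrite -mulrA -i12 mulrA e'e mul1r.
rewrite !expr2 !rmorphM.
have c2 : i1 n * i1 e' * i2 n * i1 e * i2 e = i1 n * i2 n * i2 e.
  by rewrite -(mulrA (i1 n) (i1 e')) -(mulrA (i1 n) (_ * _) (i1 e)) e'xe.
rewrite [(_ + _) * (_ + _)]mulrDr !mulrDl mulr2n !mulrA !addrA.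
congr (_ + _ + _ + _).
- by rewrite -(mulrA (i1 e') (i2 n) (i1 n)) -i12 mulrA -ne' c2.
- exact: c2.
by rewrite -(mulrA (i1 e' * i2 n) (i1 e')) -(mulrA (i1 e' * i2 n) (_ * _) (i1 e)) e'xe.
Qed.

(** Brackets are expanded by the Leibniz rule; those between the two tensor factors vanish, as do
    those inside the commutative algebra generated by m, p0, p1 and the exponentials. *)
Lemma urel_coproduct : urel M P0 P1 K (i1 e * i2 e) (i1 e' * i2 e').
Proof.
have [c1M c10 c1n] := urel_comm1 rel.
have ce x : GRing.comm x p1 -> [/\ brack x e = 0, brack x e' = 0 & brack e x = 0].
  move=> /(urel_comm_e sep rel)[xe xe'].
  by split; apply: brack_comm => //; exact: commr_sym xe.
have [m_e m_e' e_m] := ce _ (commr_sym c1M).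
have [p0_e p0_e' e_p0] := ce _ (commr_sym c10).
have [p1_e p1_e' e_p1] := ce _ (commr_refl p1).
have [n_e n_e' e_n] := ce _ (commr_sym c1n).
have p1_m : brack p1 m = 0 by rewrite brack_comm.
have p1_p0 : brack p1 p0 = 0 by rewrite brack_comm.
have p0_m : brack p0 m = 0 by rewrite brack_comm //; exact: urel_0M rel.
have p0_p0 : brack p0 p0 = 0 by rewrite brack_comm.
have zero := (m_e, m_e', e_m, p0_e, p0_e', e_p0, p1_e, p1_e', e_p1, n_e, n_e', e_n, p1_m,
  p1_p0, p0_m, p0_p0, brackN1, rmorph0, mul0r, mulr0, add0r, addr0).
have Y0 := urel_K0 rel; have Y1 := urel_K1 rel; have YN := urel_KN rel.
split.
- by apply/subr0_eq; rewrite -/(brack P0 M) /M /P0 !brackE !zero.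
- by apply/subr0_eq; rewrite -/(brack P1 M) /M /P1 !brackE !zero.
- by apply/subr0_eq; rewrite -/(brack P1 P0) /P1 /P0 !brackE !zero.
- exact: (is_expD (i12 _ _) (is_exp_morph i1 (urel_exp rel)) (is_exp_morph i2 (urel_exp rel))).
- rewrite opprD -(rmorphN i1) -(rmorphN i2).
  exact: (is_expD (i12 _ _) (is_exp_morph i1 (urel_exp' rel)) (is_exp_morph i2 (urel_exp' rel))).
- rewrite -/(brack K P0) /K /P0 !brackE !zero.
  rewrite -/(brack k p0) in Y0.
  (* (E - 1) (x) E + 1 (x) (E - 1) telescopes to E (x) E - 1. *)
  by rewrite scalerDr scalerAl -i1Z -i2Z Y0 i1B i2B !rmorph1
    mulrBl mul1r addrA subrK.
- rewrite urel_coproduct_N -/(brack K P1) /K /P1 !brackE !zero.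
  rewrite /brack Y1 -/n [RHS]mulrDl !rmorphM !mulrA; congr (_ + _).
  rewrite -[_ * i2 n * i1 e]mulrA -(i12 e n) mulrA -(rmorphM i1) (urel_E'E sep rel).
  by rewrite rmorph1 mul1r.
- rewrite urel_coproduct_N -/(brack K _) /K !brackE !zero urel_coproduct_sqr.
  rewrite -brackDr -/n; rewrite -/n -/(brack k n) in YN.
  have Ke' : brack k e' = - (alpha *: n) by exact: (urel_Ke' sep rel).
  have t1 : (alpha *+ 2) *: (i1 (brack k n) * i2 e) =
      i1 e * i2 e - i1 e' * i2 e - alpha ^+ 2 *: (i1 (n ^+ 2 * e) * i2 e).
    by rewrite scalerAl -i1Z YN !i1B i1Z !mulrBl -scalerAl.
  (* [K, E'] = - alpha N supplies exactly the doubled cross term of [urel_coproduct_sqr]. *)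
  have t2 : (alpha *+ 2) *: (i1 (brack k e') * i2 n * i2 e) =
      - (alpha ^+ 2 *: ((i1 n * i2 n * i2 e) *+ 2)).
    rewrite Ke' i1N i1Z !mulNr scalerN -!scalerAl scalerA mulrnAl -expr2.
    by rewrite -scalerMnl scalerMnr.
  have t3 : (alpha *+ 2) *: (i1 e' * i2 (brack k n)) =
      i1 e' * i2 e - i1 e' * i2 e' - alpha ^+ 2 *: (i1 e' * i2 (n ^+ 2 * e)).
    by rewrite scalerAr -i2Z YN !i2B i2Z !mulrBr -scalerAr.
  (* The terms E' (x) E of [t1] and [t3] cancel. *)
  rewrite !scalerDr t1 t2 t3 !opprD -!addrA; congr (_ + _).
  by do 2!rewrite (addrCA (- (i1 e' * i2 e)));
    rewrite addKr !(addrCA (- (i1 e' * i2 e'))) mulr2n scalerDr opprD -!addrA.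
Qed.

End Coproduct.

Section Antipode.
Variables (R : numFieldType) (T T' : algType (fps R)) (o : {linear T -> T'}).
Hypothesis oM : forall x y, o (x * y) = o y * o x.
Hypothesis o1 : o 1 = 1.
Variables (m p0 p1 k e e' : T).
Hypothesis sep : adic_separated T.
Hypothesis rel : urel m p0 p1 k e e'.
Let n := m + p0.

(* o is the identity map from an algebra to its opposite. *)
Lemma is_exp_anti (y x : T) : is_exp y x -> is_exp (o y) (o x).
Proof.
have oX i : o (y ^+ i) = o y ^+ i.
  by elim: i => [|i IH]; rewrite ?expr0 // exprS oM IH -exprSr.
move=> yx j; have := adiv_linear o (yx j).
by rewrite linearB linear_sum /=; under eq_bigr do rewrite linearZ /= oX.
Qed.

Let oZ (a : fps R) x : o (a *: x) = a *: o x.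
Proof. exact: linearZ. Qed.
Let oB x y : o (x - y) = o x - o y.
Proof. exact: linearB. Qed.

(** The exponentials exchange roles, as P1 goes to - P1. Each relation is pulled back through o to
    an identity in T with the products reversed. *)
Lemma urel_antipode :
  urel (o (p0 - n * e)) (o (- p0)) (o (- p1)) (o (- (k * e'))) (o e') (o e).
Proof.
have [c1M c10 c1n] := urel_comm1 rel.
have [p0e p0e'] := urel_comm_e sep rel (commr_sym c10).
have [ne ne'] := urel_comm_e sep rel (commr_sym c1n).
have [p1e p1e'] := urel_comm_e sep rel (commr_refl p1).
have p0n : GRing.comm p0 n by apply: commrD => //; exact: urel_0M rel.
have ee' : e * e' = 1 := urel_ee' sep rel.
have e'e : e' * e = 1 := urel_E'E sep rel.
have S_N : o (p0 - n * e) + o (- p0) = o (- (n * e)).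
  by rewrite -linearD addrAC subrr add0r.
have p0_m : GRing.comm p0 (p0 - n * e) by apply: commrB => //; apply: commrM.
have p1_m : GRing.comm p1 (p0 - n * e) by apply: commrB => //; apply: commrM.
have Y0 := urel_K0 rel; have Y1 := urel_K1 rel; have YN := urel_KN rel.
split.
- rewrite -!oM; congr (o _); exact: (commrN (commr_sym p0_m)).
- rewrite -!oM; congr (o _); exact: (commrN (commr_sym p1_m)).
- rewrite -!oM; congr (o _); exact: (commrN (commr_sym (commrN c10))).
- exact: is_exp_anti (urel_exp' rel).
- by rewrite -linearN opprK; exact: is_exp_anti (urel_exp rel).
- rewrite -!oM -oB -oZ -o1 -oB; congr (o _).
  rewrite !mulrNN -(mulrA k) -p0e' !mulrA -mulrBl scalerAl -opprB scalerN Y0.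
  by rewrite mulNr mulrBl ee' mul1r opprB.
- rewrite S_N -!oM -oB; congr (o _).
  rewrite !mulrNN -(mulrA k) -p1e' !mulrA -mulrBl -opprB Y1 -/n mulNr -mulrA ee' mulr1.
  by rewrite mulrN ne mulrA e'e mul1r.
rewrite S_N [o _ ^+ 2]expr2 -!oM -!oB -!oZ -oB; congr (o _).
rewrite !mulrNN.
have ke'ne : k * e' * (n * e) = k * n.
  by rewrite -mulrA (mulrA e') -ne' -mulrA e'e mulr1.
(* Moving e past k by [k, e] = alpha n e^2 costs the term alpha n^2 e. *)
have neke' : n * e * (k * e') = n * k - alpha *: (n ^+ 2 * e).
  have ek : e * k = k * e - alpha *: (n * e * e) by rewrite -(urel_Ke sep rel) opprB addrC subrK.
  rewrite -mulrA (mulrA e) ek mulrBl -(mulrA k) ee' mulr1 -scalerAl -(mulrA (n * e)) ee' mulr1.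
  by rewrite mulrBr -scalerAr mulrA expr2.
have e'ne2 : e' * (n * e * (n * e)) = n ^+ 2 * e.
  by rewrite !mulrA -ne' -(mulrA n) e'e mulr1 expr2.
(* The reversed bracket is - [k, n] - alpha n^2 e; after multiplication by 2 alpha the second term
   turns + alpha^2 n^2 e into the required - alpha^2 n^2 e. *)
rewrite ke'ne neke' e'ne2 addrAC -(opprB (k * n)) -opprD scalerN scalerDr YN -/n.
rewrite -scalerMnl scalerA -expr2 mulr2n addrA subrK opprD opprB [LHS]addrC.
by rewrite addrC.
Qed.

End Antipode.

(** * Completed tensor products *)

Section Tensors.
Variable R : numFieldType.

Lemma tens_tfree_ext (B C : choiceType) (W : lmodType (fps R))
    (f g : tfree R (B * C)%type -> W) :
  adic_separated W -> linear f -> linear g ->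
  (forall x y, f (tens x y) = g (tens x y)) -> f =1 g.
Proof.
by move=> sep lf lg fg; apply: tfree_ext => // -[b c]; rewrite -tens_basis fg.
Qed.

Lemma tens_linearP (B C : choiceType) (W : lmodType (fps R))
    (f g : tfree R B -> tfree R C -> W) :
  adic_separated W ->
  (forall y, linear (f^~ y)) -> (forall y, linear (g^~ y)) ->
  (forall x, linear (f x)) -> (forall x, linear (g x)) ->
  (forall b c, f (tbasis b) (tbasis c) = g (tbasis b) (tbasis c)) ->
  forall x y, f x y = g x y.
Proof.
move=> sep fl gl fr gr fg x y; move: x; apply: tfree_ext => // b.
by move: y; apply: tfree_ext.
Qed.

Section TensorAlgebra.
Variables (B C : choiceType) (A : talgebra R B) (A' : talgebra R C).
Local Notation AA := (tens_algebra A A').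

Lemma tens_algM (x x' : A) (y y' : A') :
  (tens x y : AA) * (tens x' y' : AA) = tens (x * x') (y * y').
Proof. exact: tens_mulE. Qed.

Lemma tens_multiplicative (T : algType (fps R)) (f : {linear AA -> T}) :
  adic_separated T ->
  (forall (x x' : A) (y y' : A'),
    f (tens (x * x') (y * y')) = f (tens x y) * f (tens x' y')) ->
  forall u v, f (u * v) = f u * f v.
Proof.
move=> sep ft u v.
apply: (tens_tfree_ext (f := fun u : AA => f (u * v)) (g := fun u : AA => f u * f v))
  => // [a x y|a x y|x y].
- by rewrite mulrDl -scalerAl linearP.
- by rewrite linearP mulrDl scalerAl.
apply: (tens_tfree_ext (f := fun v : AA => f ((tens x y : AA) * v))
  (g := fun v : AA => f (tens x y) * f v)) => // [a z t|a z t|x' y'].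
- by rewrite mulrDr -scalerAr linearP.
- by rewrite linearP mulrDr scalerAr.
by rewrite tens_algM ft.
Qed.

Lemma tensl_exists : exists i : {lrmorphism A -> AA}, forall x, i x = tens x (1 : A').
Proof.
apply: lrmorphism_exists => // [a x y|x y]; first exact: tensPl.
by rewrite tens_algM mul1r.
Qed.

Lemma tensr_exists : exists i : {lrmorphism A' -> AA}, forall y, i y = tens (1 : A) y.
Proof.
apply: lrmorphism_exists => // [a x y|x y]; first exact: tensPr.
by rewrite tens_algM mul1r.
Qed.

End TensorAlgebra.

Section TensMap.
Variables (B C B' C' : choiceType).

Lemma tens_map_tens (f : {linear tfree R B -> tfree R B'})
    (g : {linear tfree R C -> tfree R C'}) x y :
  tens_map f g (tens x y) = tens (f x) (g y).
Proof.
move: x y; apply: tens_linearP => [|y a u v|y a u v|x a u v|x a u v|b c].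
- exact: tfree_separated.
- by rewrite tensPl [LHS]tlinP.
- by rewrite linearP tensPl.
- by rewrite tensPr [LHS]tlinP.
- by rewrite linearP tensPr.
by rewrite tens_basis [LHS]tlin_basis.
Qed.

Lemma tens_assoc_tens (D : choiceType) (x : tfree R B) (y : tfree R C) (z : tfree R D) :
  tens_assoc (tens (tens x y) z) = tens x (tens y z).
Proof.
have lin := @tlinP R (B * C * D)%type (B * (C * D))%type (fun p => tbasis (p.1.1, (p.1.2, p.2))).
move: x y; apply: tens_linearP => [|y a u v|y a u v|x a u v|x a u v|b c].
- exact: tfree_separated.
- by rewrite !tensPl [LHS]lin.
- by rewrite tensPl.
- by rewrite tensPr tensPl [LHS]lin.
- by rewrite tensPl tensPr.
move: z; apply: tfree_ext => [|a u v|a u v|d].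
- exact: tfree_separated.
- by rewrite tensPr [LHS]lin.
- by rewrite !tensPr.
by rewrite !tens_basis [LHS]tlin_basis.
Qed.

End TensMap.

End Tensors.

(** * The opposite algebra, target of the antipode *)

Section Opposite.
Variables (R : comNzRingType) (B : choiceType) (A : talgebra R B).

Definition opp_mul (x y : tfree R B) : tfree R B := tmul A y x.

Fact opp_mulPl a x x' y : opp_mul (a *: x + x') y = a *: opp_mul x y + opp_mul x' y.
Proof. exact: tmulPr. Qed.

Fact opp_mulPr a x y y' : opp_mul x (a *: y + y') = a *: opp_mul x y + opp_mul x y'.
Proof. exact: tmulPl. Qed.

Fact opp_mulA : associative opp_mul.
Proof. by move=> x y z; rewrite /opp_mul tmul_assoc. Qed.

Fact opp_mul1l : left_id (tone A) opp_mul.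
Proof. exact: tmul_1r. Qed.

Fact opp_mul1r : right_id (tone A) opp_mul.
Proof. exact: tmul_1l. Qed.

Definition opp_algebra : talgebra R B :=
  TAlgebra opp_mulPl opp_mulPr opp_mulA opp_mul1l opp_mul1r (tone_neq0 A).

End Opposite.

(** * Construction of the coproduct, the counit and the antipode *)

Section HopfMaps.
Variables (R : numFieldType) (A : talgebra R pbw).
Hypothesis UA : Ualpha_algebra A.
Local Notation AA := (tens_algebra A A).
Local Notation M := (genM A).
Local Notation P0 := (genP0 A).
Local Notation P1 := (genP1 A).
Local Notation K := (genK A).
Local Notation E := (texp (alpha *: P1)).
Local Notation E' := (texp (- (alpha *: P1))).

Let sep : adic_separated A := @tfree_separated R pbw.
Let rel : urel M P0 P1 K E E' := ((Ualpha_urel A).1 UA).2.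

(** Monomials are products of generators. Together with linear extension from the basis, this
    reduces a property that defines a subalgebra to the generators. *)
Lemma Ualpha_basis_ind (P : A -> Prop) :
  P 1 -> P M -> P P0 -> P P1 -> P K -> (forall x y, P x -> P y -> P (x * y)) ->
  forall t, P (tbasis t).
Proof.
move=> p1 pM pP0 pP1 pK pmul [[[a b] c] d]; rewrite -(Ualpha_pbw UA).
have pX x n : P x -> P (x ^+ n).
  by move=> px; elim: n => [|n IH]; rewrite ?expr0 // exprS; apply: pmul.
by apply: (pmul _ _ (pmul _ _ (pmul _ _ _ _) _) _); exact: pX.
Qed.

Lemma comul_exists : exists D : {lrmorphism A -> AA},
  [/\ D M = tens M (1 : A) + tens E' M + tens (E' - 1) P0,
      D P0 = tens P0 (1 : A) + tens (1 : A) P0,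
      D P1 = tens P1 (1 : A) + tens (1 : A) P1,
      D K = tens K E + tens (1 : A) K &
      D E = tens E E /\ D E' = tens E' E'].
Proof.
have [i1 i1E] := tensl_exists A A; have [i2 i2E] := tensr_exists A A.
have i12 x y : i1 x * i2 y = tens x y.
  by rewrite i1E i2E tens_algM mul1r mulr1.
have i21 x y : i1 x * i2 y = i2 y * i1 x.
  by rewrite i12 i1E i2E tens_algM mul1r mulr1.
have [D [DM D0 D1 DK DE]] := Ualpha_hom UA (urel_coproduct i21 sep rel).
have i1E' : i1 E' - 1 = i1 (E' - 1) by rewrite rmorphB rmorph1.
have DM' : D M = tens M (1 : A) + tens E' M + tens (E' - 1) P0.
  by rewrite DM i1E' !i12 (i1E M).
have D0' : D P0 = tens P0 (1 : A) + tens (1 : A) P0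
  by exact: (etrans D0 (congr2 +%R (i1E _) (i2E _))).
have D1' : D P1 = tens P1 (1 : A) + tens (1 : A) P1
  by exact: (etrans D1 (congr2 +%R (i1E _) (i2E _))).
have DK' : D K = tens K E + tens (1 : A) K by exact: (etrans DK (congr2 +%R (i12 _ _) (i2E _))).
have DE' : D E = tens E E by exact: (etrans DE.1 (i12 _ _)).
have DE'' : D E' = tens E' E' by exact: (etrans DE.2 (i12 _ _)).
by exists D; exact: And5 DM' D0' D1' DK' (conj DE' DE'').
Qed.

Let rel_counit : urel (0 : (fps R)^o) 0 0 0 1 1.
Proof.
split; rewrite ?(mul0r, mulr0, oppr0, addr0, subrr, scaler0, expr0n) //; exact: is_exp0.
Qed.

(** [Ualpha_hom] only produces maps into a [talgebra], which [(fps R)^o] is not. The counit is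
    therefore given explicitly, as the coefficient of the empty monomial at each order, and
    [Ualpha_multiplicative] is applied to it. *)
Lemma counit_exists : exists c : {lrmorphism A -> (fps R)^o},
  [/\ c M = 0, c P0 = 0, c P1 = 0, c K = 0 & c E = 1 /\ c E' = 1].
Proof.
pose z : pbw := (0, 0, 0, 0)%N.
pose f (x : A) : (fps R)^o := fun n => (x n)@_z.
have f_lin : linear f.
  move=> a x y; apply/funext => n; rewrite /f.
  transitivity ((\sum_(i < n.+1) a i *: (x : tfree R pbw) (n - i)%N + y n)@_z) => //.
  rewrite mcoeffD raddf_sum /=.
  transitivity (\sum_(i < n.+1) a i * f x (n - i)%N + f y n) => //.
  by congr (_ + _); apply: eq_bigr => i _; rewrite mcoeffZ.
have fb (a b c d : nat) : f (tbasis ((a, b, c, d) : pbw)) =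
    (0 : (fps R)^o) ^+ a * 0 ^+ b * 0 ^+ c * 0 ^+ d.
  have fz t : f (tbasis t) = if t == z then 1 else 0.
    apply/funext => -[|n]; rewrite /f /tbasis /= ?mcoeffU; first by case: eqP.
    by rewrite mcoeff0; case: eqP.
  rewrite fz !expr0n -!natrM !mulnb -!pair_eqE /=.
  by case: ifP.
pose F := HB.pack_for {linear A -> (fps R)^o} f (GRing.isLinear.Build _ _ _ _ f f_lin).
have [f1 fM] := Ualpha_multiplicative UA (@fps_separated R) rel_counit
  (fb : forall a b c d, F _ = _).
have [c cE] := lrmorphism_exists f_lin f1 fM.
have cM : c M = 0 by rewrite cE (fb 1 0 0 0)%N expr1 !mul0r.
have c0 : c P0 = 0 by rewrite cE (fb 0 1 0 0)%N expr1 mulr0 !mul0r.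
have c1 : c P1 = 0 by rewrite cE (fb 0 0 1 0)%N expr1 mulr0 !mul0r.
have cK : c K = 0 by rewrite cE (fb 0 0 0 1)%N expr1 mulr0.
have cexp : c E = 1 /\ c E' = 1.
  split; last first.
    apply: (is_exp_unique (@fps_separated R) _ (urel_exp' rel_counit)).
    rewrite -c1 -(rmorphN c); exact: is_exp_morph (urel_exp' rel).
  apply: (is_exp_unique (@fps_separated R) _ (urel_exp rel_counit)).
  rewrite -c1; exact: is_exp_morph (urel_exp rel).
by exists c; exact: And5 cM c0 c1 cK cexp.
Qed.

(** A homomorphism to the opposite algebra, read as an antihomomorphism of A to itself: the two have
    the same underlying module. *)
Lemma antipode_exists : exists S : {linear A -> A},
  [/\ S 1 = 1, forall x y, S (x * y) = S y * S x &
   [/\ S M = P0 - (M + P0) * E, S P0 = - P0, S P1 = - P1, S K = - (K * E') &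
     S E = E' /\ S E' = E]].
Proof.
pose o (x : A) : opp_algebra A := x.
have o_lin : linear o by [].
pose O := HB.pack_for {linear A -> opp_algebra A} o (GRing.isLinear.Build _ _ _ _ o o_lin).
have oM x y : O (x * y) = O y * O x by [].
have [S [SM S0 S1 SK SE]] := Ualpha_hom UA (urel_antipode oM erefl sep rel).
have S_lin : linear (S : A -> A) by move=> a x y; exact: (linearP S a x y).
pose S' := HB.pack_for {linear A -> A} (S : A -> A)
  (GRing.isLinear.Build _ _ _ _ (S : A -> A) S_lin).
exists S'; split; [exact: (rmorph1 S)|exact: (rmorphM S)|].
exact: And5 SM S0 S1 SK SE.
Qed.

End HopfMaps.

(** * The Hopf axioms *)

Section HopfAxioms.
Variables (R : numFieldType) (B : choiceType) (A : talgebra R B).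
Local Notation AA := (tens_algebra A A).
Local Notation AAA := (tens_algebra A AA).
Variable D : {lrmorphism A -> AA}.

Lemma tensDl (C C' : choiceType) (x x' : tfree R C) (y : tfree R C') :
  tens (x + x') y = tens x y + tens x' y.
Proof. by have := tensPl 1 x x' y; rewrite !scale1r. Qed.
Lemma tensDr (C C' : choiceType) (x : tfree R C) (y y' : tfree R C') :
  tens x (y + y') = tens x y + tens x y'.
Proof. by have := tensPr 1 x y y'; rewrite !scale1r. Qed.

Lemma tens_assocM (u v : tens_algebra AA A) :
  (tens_assoc (u * v) : AAA) = (tens_assoc u : AAA) * (tens_assoc v : AAA).
Proof.
have lin : linear (@tens_assoc R B B B : tens_algebra AA A -> AAA) by exact: tlinP.
pose f := HB.pack_for {linear tens_algebra AA A -> AAA}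
  (@tens_assoc R B B B : tens_algebra AA A -> AAA) (GRing.isLinear.Build _ _ _ _ _ lin).
have sep : adic_separated AAA by exact: tfree_separated.
apply: (tens_multiplicative (f := f)) => // s t y y'.
apply: (tens_tfree_ext (f := fun s : AA => f (tens (s * t) (y * y')))
  (g := fun s : AA => f (tens s y) * f (tens t y'))) => // [a x z|a x z|x1 x2].
- by rewrite mulrDl -scalerAl tensPl linearP.
- by rewrite tensPl linearP mulrDl scalerAl.
apply: (tens_tfree_ext (f := fun t : AA => f (tens ((tens x1 x2 : AA) * t) (y * y')))
  (g := fun t : AA => f (tens (tens x1 x2) y) * f (tens t y'))) => // [a x z|a x z|z1 z2].
- by rewrite mulrDr -scalerAr tensPl linearP.
- by rewrite tensPl linearP mulrDr scalerAr.
rewrite tens_algM -![f _]/(tens_assoc _) !tens_assoc_tens.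
by rewrite [RHS]tens_algM tens_algM.
Qed.


Let sepAAA : adic_separated AAA := @tfree_separated R _.
Let sepA : adic_separated A := @tfree_separated R _.

(** The two sides of coassociativity as maps on all of A (x) A, where each is multiplicative; hence
    they agree after D on a subalgebra. *)
Definition coassl (u : AA) : AAA := tens_assoc (tens_map D id u).
Definition coassr (u : AA) : AAA := tens_map id D u.

Lemma tens_assoc_linear : linear (@tens_assoc R B B B).
Proof. exact: tlinP. Qed.

Lemma coassl_linear : linear coassl.
Proof. by move=> a x y; rewrite /coassl [tens_map _ _ _]tlinP [LHS]tlinP. Qed.

Lemma coassr_linear : linear coassr.
Proof. exact: tlinP. Qed.

Lemma coassl_tens (x y : A) : coassl (tens x y) = tens_assoc (tens (D x) y).
Proof. by rewrite /coassl (tens_map_tens D idfun). Qed.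

Lemma coassr_tens (x y : A) : coassr (tens x y) = tens x (D y).
Proof. by rewrite /coassr (tens_map_tens idfun D). Qed.

Lemma coasslM u v : coassl (u * v) = coassl u * coassl v.
Proof.
pose f := HB.pack_for {linear AA -> AAA} coassl (GRing.isLinear.Build _ _ _ _ _ coassl_linear).
apply: (tens_multiplicative (f := f)) => // x x' y y'.
by rewrite -![f _]/(coassl _) !coassl_tens rmorphM -tens_assocM tens_algM.
Qed.

Lemma coassrM u v : coassr (u * v) = coassr u * coassr v.
Proof.
pose f := HB.pack_for {linear AA -> AAA} coassr (GRing.isLinear.Build _ _ _ _ _ coassr_linear).
apply: (tens_multiplicative (f := f)) => // x x' y y'.
by rewrite -![f _]/(coassr _) !coassr_tens rmorphM [RHS]tens_algM.
Qed.

Lemma coassM x y :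
  coassl (D x) = coassr (D x) -> coassl (D y) = coassr (D y) ->
  coassl (D (x * y)) = coassr (D (x * y)).
Proof. by move=> cx cy; rewrite rmorphM coasslM coassrM cx cy. Qed.

Let coasslD u v : coassl (u + v) = coassl u + coassl v.
Proof. by have := coassl_linear 1 u v; rewrite !scale1r. Qed.
Let coassrD u v : coassr (u + v) = coassr u + coassr v.
Proof. by have := coassr_linear 1 u v; rewrite !scale1r. Qed.
Let assocD (u v : tfree R (B * B * B)%type) : tens_assoc (u + v) = tens_assoc u + tens_assoc v.
Proof. by have := tens_assoc_linear 1 u v; rewrite !scale1r. Qed.

Let D1 : D 1 = tens (1 : A) (1 : A).
Proof. exact: rmorph1. Qed.

Lemma coass1 : coassl (D 1) = coassr (D 1).
Proof. by rewrite D1 coassl_tens coassr_tens D1 tens_assoc_tens. Qed.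

(** Both sides are x (x) g (x) g + 1 (x) x (x) g + 1 (x) 1 (x) x. This covers K with g = E, and P0
    and P1 with g = 1. *)
Lemma coass_skew (x g : A) :
  D g = tens g g -> D x = tens x g + tens (1 : A) x -> coassl (D x) = coassr (D x).
Proof.
move=> Dg Dx; rewrite Dx coasslD coassrD !coassl_tens !coassr_tens Dg Dx D1.
by rewrite tensDl assocD !tens_assoc_tens tensDr addrA.
Qed.

Lemma coass_M (m p0 g : A) : D g = tens g g ->
  D p0 = tens p0 (1 : A) + tens (1 : A) p0 ->
  D m = tens m (1 : A) + tens g m + tens (g - 1) p0 -> coassl (D m) = coassr (D m).
Proof.
move=> Dg Dp0 Dm.
(* g - 1 is itself skew-primitive, because g is group-like; afterwards only this formula for its
   coproduct is used. *)
have DgN : D (g - 1) = tens g (g - 1) + tens (g - 1) (1 : A).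
  have -> : D (g - 1) = D g - D 1 by exact: rmorphB.
  have g1 : tens g (1 : A) = tens (g - 1) (1 : A) + tens (1 : A) (1 : A).
    by rewrite -tensDl subrK.
  have g2 : tens g g = tens g (g - 1) + tens g (1 : A) by rewrite -tensDr subrK.
  by rewrite Dg D1 g2 g1 addrA addrK.
move: (g - 1) DgN Dm => h Dh Dm.
rewrite {1}Dm !coasslD !coassl_tens Dm Dg Dh !coassrD !coassr_tens Dm Dp0 D1.
rewrite !(tensDl, assocD) !tens_assoc_tens !tensDr !addrA; set c := tens h (tens p0 _).
by congr (_ + _); rewrite 2![_ + c + _]addrAC.
Qed.

Variable eps : {lrmorphism A -> (fps R)^o}.

Definition contractl (u : AA) : A := tlin (fun p => (eps (tbasis p.1) : fps R) *: tbasis p.2) u.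
Definition contractr (u : AA) : A := tlin (fun p => (eps (tbasis p.2) : fps R) *: tbasis p.1) u.

Lemma contractl_linear : linear contractl.
Proof. exact: tlinP. Qed.

Lemma contractr_linear : linear contractr.
Proof. exact: tlinP. Qed.

Let epsP a x y : eps (a *: x + y) = a * eps x + eps y.
Proof. exact: linearP. Qed.
Let eps1 : eps 1 = 1.
Proof. exact: rmorph1. Qed.
Let epsM x y : eps (x * y) = eps x * eps y.
Proof. exact: rmorphM. Qed.

Lemma contractl_tens (x y : A) : contractl (tens x y) = (eps x : fps R) *: y.
Proof.
move: x y; apply: (tens_linearP (f := fun x y => contractl (tens x y))
  (g := fun x y => (eps x : fps R) *: y)) => [|y a u v|y a u v|x a u v|x a u v|b c].
- exact: tfree_separated.
- by rewrite tensPl [LHS]contractl_linear.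
- by rewrite epsP scalerDl scalerA.
- by rewrite tensPr [LHS]contractl_linear.
- by rewrite scalerDr !scalerA mulrC.
by rewrite tens_basis [LHS]tlin_basis.
Qed.

Lemma contractr_tens (x y : A) : contractr (tens x y) = (eps y : fps R) *: x.
Proof.
move: x y; apply: (tens_linearP (f := fun x y => contractr (tens x y))
  (g := fun x y => (eps y : fps R) *: x)) => [|y a u v|y a u v|x a u v|x a u v|b c].
- exact: tfree_separated.
- by rewrite tensPl [LHS]contractr_linear.
- by rewrite scalerDr !scalerA mulrC.
- by rewrite tensPr [LHS]contractr_linear.
- by rewrite epsP scalerDl scalerA.
by rewrite tens_basis [LHS]tlin_basis.
Qed.

Lemma scale_mul (T : algType (fps R)) (a b : fps R) (x y : T) :
  (a * b) *: (x * y) = (a *: x) * (b *: y).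
Proof. by rewrite -scalerAl -scalerAr scalerA. Qed.

Lemma contractlM u v : contractl (u * v) = contractl u * contractl v.
Proof.
pose f := HB.pack_for {linear AA -> A} contractl (GRing.isLinear.Build _ _ _ _ _ contractl_linear).
apply: (tens_multiplicative (f := f)) => // x x' y y'.
by rewrite -![f _]/(contractl _) !contractl_tens epsM scale_mul.
Qed.

Lemma contractrM u v : contractr (u * v) = contractr u * contractr v.
Proof.
pose f := HB.pack_for {linear AA -> A} contractr (GRing.isLinear.Build _ _ _ _ _ contractr_linear).
apply: (tens_multiplicative (f := f)) => // x x' y y'.
by rewrite -![f _]/(contractr _) !contractr_tens epsM scale_mul.
Qed.

Definition counital x := contractl (D x) = x /\ contractr (D x) = x.

Lemma counital1 : counital 1.
Proof. by rewrite /counital D1 contractl_tens contractr_tens eps1 scale1r. Qed.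

Lemma counitalM x y : counital x -> counital y -> counital (x * y).
Proof.
have DM : D (x * y) = D x * D y by exact: rmorphM.
by move=> [xl xr] [yl yr]; rewrite /counital DM contractlM contractrM xl xr yl yr.
Qed.

Let contractlD u v : contractl (u + v) = contractl u + contractl v.
Proof. by have := contractl_linear 1 u v; rewrite !scale1r. Qed.
Let contractrD u v : contractr (u + v) = contractr u + contractr v.
Proof. by have := contractr_linear 1 u v; rewrite !scale1r. Qed.

Lemma counital_skew (x g : A) : eps g = 1 -> eps x = 0 ->
  D x = tens x g + tens (1 : A) x -> counital x.
Proof.
move=> eg ex Dx; rewrite /counital Dx contractlD contractrD !contractl_tens !contractr_tens.
by rewrite eg ex eps1 !scale1r !scale0r add0r addr0.
Qed.

Lemma counital_M (m p0 g : A) : eps g = 1 -> eps p0 = 0 -> eps m = 0 ->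
  D m = tens m (1 : A) + tens g m + tens (g - 1) p0 -> counital m.
Proof.
have eps_g1 : eps (g - 1) = eps g - 1 by rewrite -eps1; exact: rmorphB.
move=> eg ep0 em Dm; rewrite /counital Dm !contractlD !contractrD !contractl_tens !contractr_tens.
by rewrite eps_g1 eg ep0 em eps1 subrr !scale1r !scale0r !addr0 add0r.
Qed.

Variable S : {linear A -> A}.
Hypothesis S1 : S 1 = 1.
Hypothesis SM : forall x y, S (x * y) = S y * S x.

Definition convl (u : AA) : A := tens_mu A (tens_map S id u).
Definition convr (u : AA) : A := tens_mu A (tens_map id S u).

Lemma convl_linear : linear convl.
Proof. by move=> a x y; rewrite /convl [tens_map _ _ _]tlinP [LHS]tlinP. Qed.

Lemma convr_linear : linear convr.
Proof. by move=> a x y; rewrite /convr [tens_map _ _ _]tlinP [LHS]tlinP. Qed.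

Lemma tens_mu_tens (x y : A) : tens_mu A (tens x y) = x * y.
Proof.
move: x y; apply: (tens_linearP (f := fun x y => tens_mu A (tens x y))
  (g := fun x y : A => x * y)) => [|y a u v|y a u v|x a u v|x a u v|b c].
- exact: tfree_separated.
- by rewrite tensPl [LHS]tlinP.
- exact: tmulPl.
- by rewrite tensPr [LHS]tlinP.
- exact: tmulPr.
by rewrite tens_basis [LHS]tlin_basis.
Qed.

Lemma convl_tens (x y : A) : convl (tens x y) = S x * y.
Proof. by rewrite /convl (tens_map_tens S idfun) tens_mu_tens. Qed.

Lemma convr_tens (x y : A) : convr (tens x y) = x * S y.
Proof. by rewrite /convr (tens_map_tens idfun S) tens_mu_tens. Qed.

(** [convl] is not multiplicative. As S reverses products, the value of [convl] on u (c (x) d) is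
    S(c) convl(u) d, and the scalar convl(u) = a can be pulled out. *)
Lemma convl_mul a u v : convl u = a *: 1 -> convl (u * v) = a *: convl v.
Proof.
pose f := HB.pack_for {linear AA -> A} convl (GRing.isLinear.Build _ _ _ _ _ convl_linear).
move=> ua; move: v; apply: (tens_tfree_ext (f := fun v : AA => f (u * v))
  (g := fun v : AA => a *: f v)) => [|b x y|b x y|c d].
- exact: tfree_separated.
- by rewrite mulrDr -scalerAr linearP.
- by rewrite linearP scalerDr !scalerA mulrC.
have -> : f (u * tens c d) = S c * f u * d.
  move: u {ua}; apply: (tens_tfree_ext (f := fun u : AA => f (u * tens c d))
    (g := fun u : AA => S c * f u * d)) => [|b x y|b x y|x y].
  - exact: tfree_separated.
  - by rewrite mulrDl -scalerAl linearP.
  - by rewrite linearP mulrDr mulrDl scalerAl scalerAr.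
  by rewrite tens_algM -![f _]/(convl _) !convl_tens SM !mulrA.
by rewrite -![f _]/(convl _) ua convl_tens -scalerAr mulr1 scalerAl.
Qed.

Lemma convr_mul a u v : convr v = a *: 1 -> convr (u * v) = a *: convr u.
Proof.
pose f := HB.pack_for {linear AA -> A} convr (GRing.isLinear.Build _ _ _ _ _ convr_linear).
move=> va; move: u; apply: (tens_tfree_ext (f := fun u : AA => f (u * v))
  (g := fun u : AA => a *: f u)) => [|b x y|b x y|c d].
- exact: tfree_separated.
- by rewrite mulrDl -scalerAl linearP.
- by rewrite linearP scalerDr !scalerA mulrC.
have -> : f ((tens c d : AA) * v) = (c : A) * f v * S d.
  move: v {va}; apply: (tens_tfree_ext (f := fun v : AA => f ((tens c d : AA) * v))
    (g := fun v : AA => (c : A) * f v * S d)) => [|b x y|b x y|x y].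
  - exact: tfree_separated.
  - by rewrite mulrDr -scalerAr linearP.
  - by rewrite linearP mulrDr mulrDl scalerAl scalerAr.
  by rewrite tens_algM -![f _]/(convr _) !convr_tens SM !mulrA.
by rewrite -![f _]/(convr _) va convr_tens -scalerAr mulr1 scalerAl.
Qed.

Definition convolutive x :=
  convl (D x) = (eps x : fps R) *: 1 /\ convr (D x) = (eps x : fps R) *: 1.

Lemma convolutive1 : convolutive 1.
Proof. by rewrite /convolutive D1 convl_tens convr_tens S1 eps1 scale1r mulr1. Qed.

Lemma convolutiveM x y : convolutive x -> convolutive y -> convolutive (x * y).
Proof.
have DM : D (x * y) = D x * D y by exact: rmorphM.
move=> [xl xr] [yl yr]; rewrite /convolutive DM (convl_mul _ xl) (convr_mul _ yr) yl xr epsM.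
by rewrite !scalerA [_ * eps x]mulrC.
Qed.

Let convlD u v : convl (u + v) = convl u + convl v.
Proof. by have := convl_linear 1 u v; rewrite !scale1r. Qed.
Let convrD u v : convr (u + v) = convr u + convr v.
Proof. by have := convr_linear 1 u v; rewrite !scale1r. Qed.

Lemma convolutive_skew (x g g' : A) : g' * g = 1 -> S g = g' -> S x = - (x * g') ->
  eps x = 0 -> D x = tens x g + tens (1 : A) x -> convolutive x.
Proof.
move=> g'g Sg Sx ex Dx; rewrite /convolutive Dx convlD convrD !convl_tens !convr_tens.
by rewrite ex S1 Sx Sg mulNr -mulrA g'g mulr1 !mul1r addNr subrr scale0r.
Qed.

(** Both convolutions vanish because g' commutes with m + p0 and is inverse to g; the value of S m
    amounts to S (m + p0) = - (m + p0) g'. *)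
Lemma convolutive_M (m p0 g g' : A) : g * g' = 1 -> g' * g = 1 ->
  GRing.comm g' (m + p0) ->
  S g = g' -> S p0 = - p0 -> S m = p0 - (m + p0) * g' -> eps m = 0 ->
  D m = tens m (1 : A) + tens g m + tens (g - 1) p0 -> convolutive m.
Proof.
move=> gg' g'g g'n Sg Sp0 Sm em Dm; have Sg1 : S (g - 1) = g' - 1 by rewrite linearB Sg S1.
rewrite /convolutive Dm !convlD !convrD !convl_tens !convr_tens Sg Sp0 Sm S1 Sg1 em scale0r.
have e1 : (m + p0) * g' = g' * m + g' * p0 by rewrite -mulrDr g'n.
have e2 : g * ((m + p0) * g') = m + p0 by rewrite -g'n mulrA gg' mul1r.
split; first by rewrite mulr1 mulrBl mul1r e1 -addrA (addrA (g' * m)) addrA subrK subrr.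
rewrite mulr1 mulrBr e2 mulrN mulrBl mul1r opprB -addrA [_ - _ + _]addrC -!addrA addKr.
by rewrite addrA subrr.
Qed.

Lemma hopf_exists :
  (forall x, coassl (D x) = coassr (D x)) -> (forall x, counital x) ->
  (forall x, convolutive x) -> exists H : hopf A, forall x, comul H x = D x.
Proof.
move=> ca cu cv.
by exists (Hopf ca (fun x => (cu x).1) (fun x => (cu x).2) (fun x => (cv x).1)
  (fun x => (cv x).2)).
Qed.

Lemma coass_ext : (forall t, coassl (D (tbasis t)) = coassr (D (tbasis t))) ->
  forall x, coassl (D x) = coassr (D x).
Proof.
move=> ca; apply: (tfree_ext (f := fun x : A => coassl (D x))
  (g := fun x : A => coassr (D x))) => [|a u v|a u v|t] //.
- by rewrite (linearP D) coassl_linear.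
- by rewrite (linearP D) coassr_linear.
Qed.

Lemma counital_ext : (forall t, counital (tbasis t)) -> forall x, counital x.
Proof.
move=> cu x; split; move: x.
  apply: (tfree_ext (f := fun x : A => contractl (D x)) (g := fun x : A => x))
    => [|a u v|a u v|t] //.
  - by rewrite (linearP D) contractl_linear.
  - exact: (cu t).1.
apply: (tfree_ext (f := fun x : A => contractr (D x)) (g := fun x : A => x))
    => [|a u v|a u v|t] //.
- by rewrite (linearP D) contractr_linear.
- exact: (cu t).2.
Qed.

Lemma convolutive_ext : (forall t, convolutive (tbasis t)) -> forall x, convolutive x.
Proof.
move=> cv x.
have eps_lin a u v : (eps (a *: u + v) : fps R) *: (1 : A) =
    a *: ((eps u : fps R) *: 1) + (eps v : fps R) *: 1.
  by rewrite epsP scalerDl scalerA.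
split; move: x.
  apply: (tfree_ext (f := fun x : A => convl (D x))
    (g := fun x : A => (eps x : fps R) *: (1 : A))) => [|a u v|a u v|t] //.
  - by rewrite (linearP D) convl_linear.
  - exact: (cv t).1.
apply: (tfree_ext (f := fun x : A => convr (D x))
  (g := fun x : A => (eps x : fps R) *: (1 : A))) => [|a u v|a u v|t] //.
- by rewrite (linearP D) convr_linear.
- exact: (cv t).2.
Qed.

End HopfAxioms.

(** * The limit alpha = 0 *)

Section ClassicalLimit.
Variable R : numFieldType.

Section Bracket.
Variables (T : algType (fps R)) (m p0 p1 k e e' : T).
Hypothesis sep : adic_separated T.
Hypothesis rel : urel m p0 p1 k e e'.

(** E - 1 - alpha P1 is divisible by alpha^2; one factor alpha is cancelled. *)
Lemma urel_K0_limit : adiv 1 (brack k p0 - p1).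
Proof.
apply: adiv_alpha_cancel => //; rewrite scalerBr (urel_K0 rel).
exact: is_exp_adiv2 (urel_exp rel).
Qed.

Lemma urel_K1_limit : adiv 1 (brack k p1 - (m + p0)).
Proof.
rewrite /brack (urel_K1 rel) -[X in _ - X]mulr1 -mulrBr; apply: adiv_mull.
exact: is_exp_adiv1 (urel_exp rel).
Qed.

(** [K, M + P0] and [K, P0] have the same limit P1. *)
Lemma urel_KM_limit : adiv 1 (brack k m).
Proof.
suff KN : adiv 1 (brack k (m + p0) - p1).
  have -> : brack k m = (brack k (m + p0) - p1) - (brack k p0 - p1).
    by rewrite brackDr opprB addrA subrK addrK.
  by apply: adivB => //; exact: urel_K0_limit.
have two : (brack k (m + p0) - p1) = fpsC 2^-1 *: ((brack k (m + p0) - p1) *+ 2).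
  by rewrite -scalerMnr double_half.
rewrite two; apply/adivZ/adiv_alpha_cancel => //.
(* E and E' are compared with their expansions to first order, so every term on the right is
   divisible by alpha^2. *)
have -> : alpha *: ((brack k (m + p0) - p1) *+ 2) =
    (e - 1 - alpha *: p1) - (e' - 1 - alpha *: (- p1)) - alpha ^+ 2 *: ((m + p0) ^+ 2 * e).
  rewrite -scalerMnr scalerMnl scalerBr (urel_KN rel) addrAC; congr (_ - _).
  rewrite scalerN opprK (opprD (e' - 1)) [RHS]addrACA -opprD (opprB e') addrA subrK.
  by rewrite -mulr2n scalerMnl.
apply: adivB; last by exists ((m + p0) ^+ 2 * e).
by apply: adivB; [exact: is_exp_adiv2 (urel_exp rel)|exact: is_exp_adiv2 (urel_exp' rel)].
Qed.

Lemma brackZl a (x y : T) : brack (a *: x) y = a *: brack x y.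
Proof. by rewrite /brack -scalerAl -scalerAr scalerBr. Qed.

Lemma brackZr a (x y : T) : brack x (a *: y) = a *: brack x y.
Proof. by rewrite /brack -scalerAl -scalerAr scalerBr. Qed.

Lemma urel_bracket xM x0 x1 xK yM y0 y1 yK :
  brack (xM *: m + x0 *: p0 + x1 *: p1 + xK *: k) (yM *: m + y0 *: p0 + y1 *: p1 + yK *: k) =
  (xK * yM - xM * yK) *: brack k m + (xK * y0 - x0 * yK) *: brack k p0 +
  (xK * y1 - x1 * yK) *: brack k p1.
Proof.
have cM x : brack x x = 0 by rewrite brack_comm.
have bN (x y : T) : brack x y = - brack y x by rewrite /brack opprB.
have b0m : brack p0 m = 0 by rewrite brack_comm //; exact: urel_0M rel.
have b1m : brack p1 m = 0 by rewrite brack_comm //; exact: urel_1M rel.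
have b10 : brack p1 p0 = 0 by rewrite brack_comm //; exact: urel_10 rel.
have bm0 : brack m p0 = 0 by rewrite bN b0m oppr0.
have bm1 : brack m p1 = 0 by rewrite bN b1m oppr0.
have b01 : brack p0 p1 = 0 by rewrite bN b10 oppr0.
rewrite !(brackDl, brackDr, brackZl, brackZr) !cM b0m b1m b10 bm0 bm1 b01 !scaler0 !add0r !addr0.
rewrite (bN m k) (bN p0 k) (bN p1 k) !scalerN !scalerA !scalerBl.
by rewrite !scalerDr !scalerA [LHS]addrC addrACA; congr (_ + _); rewrite addrACA.
Qed.

Lemma urel_bracket_limit a b c :
  adiv 1 (a *: brack k m + b *: brack k p0 + c *: brack k p1 - (b *: p1 + c *: (m + p0))).
Proof.
have -> : a *: brack k m + b *: brack k p0 + c *: brack k p1 - (b *: p1 + c *: (m + p0)) =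
    a *: brack k m + b *: (brack k p0 - p1) + c *: (brack k p1 - (m + p0)).
  by rewrite !(scalerBr, opprD) addrACA !addrA.
by do 2?apply: adivD; apply: adivZ;
  [exact: urel_KM_limit|exact: urel_K0_limit|exact: urel_K1_limit].
Qed.

End Bracket.

Lemma adiv_eqmod (B : choiceType) n (x y : tfree R B) : adiv n (x - y) -> eqmod n x y.
Proof. by move=> xy m mn; apply/eqP; rewrite -subr_eq0; apply/eqP; exact: (adiv_tfree xy mn). Qed.

Section Tensor.
Variables (B : choiceType) (A : talgebra R B).
Local Notation AA := (tens_algebra A A).

Lemma tensBl (x x' y : A) : tens (x - x') y = tens x y - tens x' y :> AA.
Proof. by have := tensPl (-1) x' x y; rewrite !scaleN1r addrC [RHS]addrC. Qed.

Lemma tensBr (x y y' : A) : tens x (y - y') = tens x y - tens x y' :> AA.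
Proof. by have := tensPr (-1) x y' y; rewrite !scaleN1r addrC [RHS]addrC. Qed.

Lemma tensZr a (x y : A) : tens x (a *: y) = a *: tens x y.
Proof.
have t0 : tens x (0 : A) = 0 by have := tensBr x 0 0; rewrite !subrr.
by have := tensPr a x y 0; rewrite t0 !addr0.
Qed.

Lemma adiv_tensl n (x y : A) : adiv n x -> adiv n (tens x y).
Proof. by move=> [z ->]; exists (tens z y); exact: tlinZ. Qed.

Lemma adiv_tensr n (x y : A) : adiv n y -> adiv n (tens x y).
Proof. by move=> [z ->]; exists (tens x z); exact: tensZr. Qed.

Lemma tens_flip_tens (x y : A) : tens_flip (tens x y) = tens y x.
Proof.
move: x y; apply: (tens_linearP (f := fun x y => tens_flip (tens x y))
  (g := fun x y => tens y x)) => [|y a u v|y a u v|x a u v|x a u v|b c].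
- exact: tfree_separated.
- by rewrite tensPl [LHS]tlinP.
- by rewrite tensPr.
- by rewrite tensPr [LHS]tlinP.
- by rewrite tensPl.
by rewrite tens_basis [LHS]tlin_basis tens_basis.
Qed.

Lemma comul_skew_limit (x g : A) : adiv 1 (g - 1) ->
  adiv 1 (tens x g + tens (1 : A) x - (tens x (1 : A) + tens (1 : A) x) : AA).
Proof. by move=> g1; rewrite opprD addrACA subrr addr0 -tensBr; exact: adiv_tensr. Qed.

Lemma comul_M_limit (m p0 g : A) : adiv 1 (g - 1) ->
  adiv 1 (tens m (1 : A) + tens g m + tens (g - 1) p0 - (tens m (1 : A) + tens (1 : A) m) : AA).
Proof.
move=> g1; rewrite -[X in X - _]addrA opprD addrACA subrr add0r addrAC -tensBl.
by apply: adivD; exact: adiv_tensl.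
Qed.

Definition antisym (x y : A) : AA := tens x y - tens y x.

Lemma antisymB x y z : antisym x (y - z) = antisym x y - antisym x z.
Proof. by rewrite /antisym tensBl tensBr !opprD opprK addrACA. Qed.

Lemma antisymN x y : antisym x (- y) = - antisym x y.
Proof.
have a0 : antisym x 0 = 0 by have := antisymB x 0 0; rewrite !subrr.
by rewrite -[- y]add0r antisymB a0 add0r.
Qed.

Lemma antisymZ a x y : antisym x (a *: y) = a *: antisym x y.
Proof.
by rewrite /antisym scalerBr; congr (_ - _); [exact: tensZr|exact: tlinZ].
Qed.

Lemma adiv_antisym n x y : adiv n y -> adiv n (antisym x y).
Proof. by move=> ny; apply: adivB; [exact: adiv_tensr|exact: adiv_tensl]. Qed.

(** The coproduct minus its flip is the wedge of x with g - 1, and g - 1 is alpha p1 modulo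
    alpha^2. *)
Lemma comul_skew_antisym (x g p1 : A) : adiv 2 (g - 1 - alpha *: p1) ->
  adiv 2 (tens x g + tens (1 : A) x - (tens g x + tens x (1 : A)) - alpha *: antisym x p1).
Proof.
move=> /(adiv_antisym x); rewrite !antisymB antisymZ.
have -> : antisym x g - antisym x 1 =
    tens x g + tens (1 : A) x - (tens g x + tens x (1 : A)) :> AA.
  by rewrite /antisym opprB opprD addrACA.
by [].
Qed.

(** The coproduct minus its flip is minus the wedge of m + p0 with g - 1; here g is E', whose
    first-order term - alpha p1 restores the sign. *)
Lemma comul_M_antisym (m p0 g p1 : A) : adiv 2 (g - 1 - alpha *: - p1) ->
  adiv 2 (tens m (1 : A) + tens g m + tens (g - 1) p0 -
    (tens (1 : A) m + tens m g + tens p0 (g - 1)) -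
    (alpha *: antisym m p1 + alpha *: antisym p0 p1)).
Proof.
move=> g2; have := adivN (adivD (adiv_antisym m g2) (adiv_antisym p0 g2)).
have aE x : antisym x (g - 1 - alpha *: - p1) = antisym x (g - 1) + alpha *: antisym x p1.
  by rewrite [LHS]antisymB antisymZ antisymN scalerN opprK.
rewrite !aE addrACA opprD.
have -> // : - (antisym m (g - 1) + antisym p0 (g - 1)) =
   tens m (1 : A) + tens g m + tens (g - 1) p0 -
    (tens (1 : A) m + tens m g + tens p0 (g - 1)) :> AA.
rewrite opprD (antisymB m) /antisym !opprB [in RHS]opprD [RHS]addrACA; congr (_ + _).
by rewrite opprD addrACA.
Qed.

End Tensor.
Lemma g_lie_coef (k : comNzRingType) (X Y : 'rV[k]_4) :
  [/\ g_lie X Y 0 iM = X 0 iK * Y 0 iP1 - X 0 iP1 * Y 0 iK,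
      g_lie X Y 0 iP0 = X 0 iK * Y 0 iP1 - X 0 iP1 * Y 0 iK,
      g_lie X Y 0 iP1 = X 0 iK * Y 0 iP0 - X 0 iP0 * Y 0 iK & g_lie X Y 0 iK = 0].
Proof.
by split; rewrite !mxE -!val_eqE /= ?(mulr0, mulr1, addr0, add0r).
Qed.

(** * Comparison with the Lie bialgebra on linear combinations of generators *)

Section Quantization.
Variable A : talgebra R pbw.
Hypothesis UA : Ualpha_algebra A.
Local Notation AA := (tens_algebra A A).
Local Notation M := (genM A).
Local Notation P0 := (genP0 A).
Local Notation P1 := (genP1 A).
Local Notation K := (genK A).
Local Notation E := (texp (alpha *: P1)).
Local Notation E' := (texp (- (alpha *: P1))).
Local Notation gen := (@generators R A).
Local Notation L := (g_bialgebra (@alpha R)).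

Lemma ord4_ind (P : 'I_4 -> Prop) : P iM -> P iP0 -> P iP1 -> P iK -> forall i, P i.
Proof.
move=> pM p0 p1 pK [[|[|[|[|//]]]] h].
- by rewrite (_ : Ordinal h = iM) //; apply: val_inj.
- by rewrite (_ : Ordinal h = iP0) //; apply: val_inj.
- by rewrite (_ : Ordinal h = iP1) //; apply: val_inj.
- by rewrite (_ : Ordinal h = iK) //; apply: val_inj.
Qed.

Lemma sum_ord4 (V : zmodType) (F : 'I_4 -> V) : \sum_i F i = F iM + F iP0 + F iP1 + F iK.
Proof.
rewrite !big_ord_recl big_ord0 addr0 !addrA.
by congr (_ + _ + _ + _); congr F; apply: val_inj.
Qed.

Let sep : adic_separated A := @tfree_separated R pbw.
Let rel : urel M P0 P1 K E E' := ((Ualpha_urel A).1 UA).2.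

Lemma gmapE (X : 'rV[fps R]_4) :
  gmap gen X = X 0 iM *: M + X 0 iP0 *: P0 + X 0 iP1 *: P1 + X 0 iK *: K.
Proof. exact: sum_ord4. Qed.

Lemma gmap_lie (X Y : 'rV[fps R]_4) : gmap gen (lie L X Y) =
  (X 0 iK * Y 0 iP0 - X 0 iP0 * Y 0 iK) *: P1 +
  (X 0 iK * Y 0 iP1 - X 0 iP1 * Y 0 iK) *: (M + P0).
Proof.
have [lM l0 l1 lK] := g_lie_coef X Y.
by rewrite gmapE lM l0 l1 lK scale0r addr0 [LHS]addrC scalerDr.
Qed.

Lemma gmap_bracket (X Y : 'rV[fps R]_4) : tbracket (gmap gen X) (gmap gen Y) =
  (X 0 iK * Y 0 iM - X 0 iM * Y 0 iK) *: brack K M +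
  (X 0 iK * Y 0 iP0 - X 0 iP0 * Y 0 iK) *: brack K P0 +
  (X 0 iK * Y 0 iP1 - X 0 iP1 * Y 0 iK) *: brack K P1.
Proof. by rewrite !gmapE; exact: (urel_bracket rel). Qed.

Lemma gmap_bracket_limit (X Y : 'rV[fps R]_4) :
  eqmod 1 (tbracket (gmap gen X) (gmap gen Y)) (gmap gen (lie L X Y)).
Proof.
apply: adiv_eqmod; rewrite gmap_bracket gmap_lie.
exact: (urel_bracket_limit sep rel).
Qed.

Lemma gmap_linear : linear (gmap gen : 'rV[fps R]_4 -> A).
Proof.
move=> a X Y; rewrite /gmap scaler_sumr -big_split /=; apply: eq_bigr => i _.
by rewrite !mxE scalerDl scalerA.
Qed.

Lemma gmap2_linear : linear (gmap2 gen : 'M[fps R]_4 -> AA).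
Proof.
move=> a S T; rewrite /gmap2 scaler_sumr -big_split /=; apply: eq_bigr => i _.
rewrite scaler_sumr -big_split /=; apply: eq_bigr => j _.
by rewrite !mxE scalerDl scalerA.
Qed.

Lemma gmap_ebase i : gmap gen (ebase (fps R) i) = gen i.
Proof.
rewrite /gmap (bigD1 i) //= big1 => [|j ji]; rewrite mxE eqxx.
  by rewrite eqxx scale1r addr0.
by rewrite (negbTE ji) scale0r.
Qed.

Lemma gmap2_ltens i j :
  gmap2 gen (ltens (ebase (fps R) i) (ebase (fps R) j)) = tens (gen i) (gen j).
Proof.
have lE p q : ltens (ebase (fps R) i) (ebase (fps R) j) p q = ((p == i) && (q == j))%:R.
  by rewrite !mxE big_ord1 !mxE eqxx -natrM mulnb.
rewrite /gmap2 (bigD1 i) //= [X in _ + X]big1 => [|p pi]; last first.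
  by rewrite big1 // => q _; rewrite lE (negbTE pi) scale0r.
rewrite addr0 (bigD1 j) //= big1 => [|q qj]; rewrite lE eqxx.
  by rewrite eqxx scale1r addr0.
by rewrite (negbTE qj) scale0r.
Qed.

(** Divisibility is stable under R[[alpha]]-combinations, so a limit condition linear in X need only
    be checked on the four basis vectors. *)
Lemma adiv_row (W : lmodType (fps R)) n (f : 'rV[fps R]_4 -> W) : linear f ->
  (forall i, adiv n (f (ebase (fps R) i))) -> forall X, adiv n (f X).
Proof.
move=> lf fi X.
pose F := HB.pack_for {linear 'rV[fps R]_4 -> W} f (GRing.isLinear.Build _ _ _ _ f lf).
rewrite -[f X]/(F X) [X]row_sum_delta linear_sum; apply: adiv_sum => i _.
by rewrite linearZ; apply: adivZ; apply: fi.
Qed.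

Lemma linear_sub (U W : lmodType (fps R)) (f g : U -> W) :
  linear f -> linear g -> linear (fun x => f x - g x).
Proof. by move=> fl gl a x y; rewrite fl gl scalerBr opprD addrACA. Qed.

Variable H : hopf A.
Hypothesis UH : Ualpha_coproduct H.

Let E1 : adiv 1 (E - 1) := is_exp_adiv1 (urel_exp rel).
Let E'1 : adiv 1 (E' - 1) := is_exp_adiv1 (urel_exp' rel).
Let E2 : adiv 2 (E - 1 - alpha *: P1) := is_exp_adiv2 (urel_exp rel).
Let E'2 : adiv 2 (E' - 1 - alpha *: (- P1)) := is_exp_adiv2 (urel_exp' rel).

Lemma comul_primitive_limit (X : 'rV[fps R]_4) :
  eqmod 1 (comul H (gmap gen X)) (tens (gmap gen X) (1 : A) + tens (1 : A) (gmap gen X)).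
Proof.
apply: adiv_eqmod; move: X.
pose f (x : A) : AA := comul H x - (tens x (1 : A) + tens (1 : A) x).
have f_lin : linear f.
  move=> a x y; rewrite /f linearP tensPl tensPr.
  by rewrite scalerBr scalerDr [in RHS]addrACA -opprD addrACA.
apply: (adiv_row (f := fun X => f (gmap gen X))) => [a X Y|i].
  by rewrite gmap_linear f_lin.
rewrite gmap_ebase; move: i; apply: ord4_ind; rewrite /f /generators /=.
- by rewrite (Ualpha_comulM UH); exact: (comul_M_limit _ _ E'1).
- by rewrite (Ualpha_comulP0 UH) subrr; exact: adiv0.
- by rewrite (Ualpha_comulP1 UH) subrr; exact: adiv0.
- by rewrite (Ualpha_comulK UH); exact: (comul_skew_limit _ E1).
Qed.

Let tens_flip_linear : linear (@tens_flip R pbw pbw).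
Proof. exact: tlinP. Qed.

Let tens_flipD (u v : AA) : tens_flip (u + v) = tens_flip u + tens_flip v :> AA.
Proof. by have := tens_flip_linear 1 u v; rewrite !scale1r. Qed.

Let gmap2_wedge i j : gmap2 gen (wedge (ebase (fps R) i) (ebase (fps R) j)) =
  antisym (gen i) (gen j).
Proof.
rewrite /antisym -!gmap2_ltens /wedge addrC.
have := gmap2_linear (-1) (ltens (ebase (fps R) j) (ebase (fps R) i))
  (ltens (ebase (fps R) i) (ebase (fps R) j)).
by rewrite !scaleN1r => ->; rewrite addrC.
Qed.

Let gmap2_scale a (T : 'M[fps R]_4) : gmap2 gen (a *: T) = a *: gmap2 gen T.
Proof.
have g0 : gmap2 gen 0 = 0.
  by have := gmap2_linear (-1) 0 0; rewrite !scaleN1r oppr0 addr0 addNr.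
by have := gmap2_linear a T 0; rewrite g0 !addr0.
Qed.

Let gmap2D (S T : 'M[fps R]_4) : gmap2 gen (S + T) = gmap2 gen S + gmap2 gen T.
Proof. by have := gmap2_linear 1 S T; rewrite !scale1r. Qed.

Let gmap2_cob :
  [/\ gmap2 gen (cob L (ebase (fps R) iM)) = alpha *: antisym M P1 + alpha *: antisym P0 P1,
      gmap2 gen (cob L (ebase (fps R) iP0)) = 0, gmap2 gen (cob L (ebase (fps R) iP1)) = 0 &
      gmap2 gen (cob L (ebase (fps R) iK)) = alpha *: antisym K P1].
Proof.
have g0 : gmap2 gen 0 = 0 by rewrite -(scale0r 0) gmap2_scale scale0r.
have gw i j : gmap2 gen (alpha *: wedge (ebase (fps R) i) (ebase (fps R) j)) =
    alpha *: antisym (gen i) (gen j).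
  by rewrite gmap2_scale gmap2_wedge.
have [cM c0 c1 cK] := g_cob_table (@alpha R); split.
- apply: (etrans (congr1 (gmap2 gen) cM)).
  exact: (etrans (gmap2D _ _) (congr2 +%R (gw _ _) (gw _ _))).
- exact: (etrans (congr1 (gmap2 gen) c0) g0).
- exact: (etrans (congr1 (gmap2 gen) c1) g0).
exact: (etrans (congr1 (gmap2 gen) cK) (gw _ _)).
Qed.

Lemma comul_cobracket_limit (X : 'rV[fps R]_4) :
  eqmod 2 ((comul H (gmap gen X) : tfree R (pbw * pbw)%type)
             - tens_flip (comul H (gmap gen X)))
    (gmap2 gen (cob L X)).
Proof.
apply: adiv_eqmod; move: X.
pose f (X : 'rV[fps R]_4) : AA :=
  comul H (gmap gen X) - tens_flip (comul H (gmap gen X)) - gmap2 gen (cob L X).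
have D_lin : linear (fun X : 'rV[fps R]_4 => comul H (gmap gen X)).
  by move=> a X Y; rewrite gmap_linear (linearP (comul H)).
have f_lin : linear f.
  apply: linear_sub; last first.
    move=> a X Y.
    exact: (etrans (congr1 (gmap2 gen) (cob_linear L a X Y)) (gmap2_linear _ _ _)).
  by apply: linear_sub => // a X Y; rewrite D_lin tens_flip_linear.
apply: (adiv_row f_lin) => i.
have [cM c0 c1 cK] := gmap2_cob.
rewrite /f gmap_ebase; move: i; apply: ord4_ind.
- rewrite cM -[gen iM]/(M) (Ualpha_comulM UH) !tens_flipD !tens_flip_tens.
  exact: (comul_M_antisym _ _ E'2).
- rewrite c0 subr0 -[gen iP0]/(P0) (Ualpha_comulP0 UH) tens_flipD !tens_flip_tens.
  by rewrite [X in _ - X]addrC subrr; exact: adiv0.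
- rewrite c1 subr0 -[gen iP1]/(P1) (Ualpha_comulP1 UH) tens_flipD !tens_flip_tens.
  by rewrite [X in _ - X]addrC subrr; exact: adiv0.
rewrite cK -[gen iK]/(K) (Ualpha_comulK UH) tens_flipD !tens_flip_tens.
exact: (comul_skew_antisym _ E2).
Qed.

End Quantization.
End ClassicalLimit.

(** * The Hopf algebra assembled, and the quantization theorem *)

Lemma Ualpha_hopf (R : numFieldType) (A : talgebra R pbw) : Ualpha_algebra A ->
  exists H : hopf A, Ualpha_coproduct H.
Proof.
move=> UA; have [_ rel] := (Ualpha_urel A).1 UA.
have sep : adic_separated A by exact: tfree_separated.
have [D [DM D0 D1 DK [DE DE']]] := comul_exists UA.
have [eps [eM e0 e1 eK [eE eE']]] := counit_exists UA.
have [S [S1 SM [SgM Sg0 Sg1 SgK [SE SE']]]] := antipode_exists UA.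
have ee' := urel_ee' sep rel; have e'e := urel_E'E sep rel.
have D_1 : D 1 = tens (1 : A) (1 : A) by exact: rmorph1.
have eps_1 : eps 1 = 1 by exact: rmorph1.
(* A primitive element is skew-primitive for g = 1, so P0 and P1 share the antipode lemma of K. *)
have S_prim (x : A) : S x = - x -> S x = - (x * 1) by rewrite mulr1.
have [_ _ c1n] := urel_comm1 rel.
have cEn : GRing.comm (texp (alpha *: genP1 A) : A) (genM A + genP0 A).
  exact: commr_sym (urel_comm_e sep rel (commr_sym c1n)).1.
have ca : forall x, coassl D (D x) = coassr D (D x).
  apply: coass_ext; apply: (Ualpha_basis_ind UA (P := fun x => coassl D (D x) = coassr D (D x))).
  - exact: coass1.
  - exact: coass_M DE' D0 DM.
  - exact: coass_skew D_1 D0.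
  - exact: coass_skew D_1 D1.
  - exact: coass_skew DE DK.
  - exact: coassM.
have cu : forall x, counital D eps x.
  apply: counital_ext; apply: (Ualpha_basis_ind UA (P := counital D eps)).
  - exact: counital1.
  - exact: counital_M eE' e0 eM DM.
  - exact: counital_skew eps_1 e0 D0.
  - exact: counital_skew eps_1 e1 D1.
  - exact: counital_skew eE eK DK.
  - exact: counitalM.
have cv : forall x, convolutive D eps S x.
  apply: convolutive_ext; apply: (Ualpha_basis_ind UA (P := convolutive D eps S)).
  - exact: convolutive1.
  (* For M the group-like element is E' and its inverse E, the reverse of the situation for K. *)
  - exact: (convolutive_M S1 e'e ee' cEn SE' Sg0 SgM eM DM).
  - exact: (convolutive_skew S1 (mulr1 1) S1 (S_prim _ Sg0) e0 D0).
  - exact: (convolutive_skew S1 (mulr1 1) S1 (S_prim _ Sg1) e1 D1).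
  - exact: (convolutive_skew S1 e'e SE SgK eK DK).
  - exact: convolutiveM.
have [H HD] := hopf_exists ca cu cv.
exists H; split.
- exact: (etrans (HD _) DM).
- exact: (etrans (HD _) D0).
- exact: (etrans (HD _) D1).
exact: (etrans (HD _) DK).
Qed.

Theorem proposition4p2 (R : realType) :
  (exists A : talgebra R pbw, Ualpha_algebra A) /\
  (forall A : talgebra R pbw, Ualpha_algebra A ->
     exists H : hopf A,
       Ualpha_coproduct H /\
       quantizes (@generators R A) (g_bialgebra (@alpha R)) H).
Proof.
split=> [|A UA]; first exact: Ualpha_exists.
have [H UH] := Ualpha_hopf UA; exists H; split=> //; split=> [X Y|X|X].
- exact: (gmap_bracket_limit UA X Y).
- exact: (comul_primitive_limit UA UH X).
- exact: (comul_cobracket_limit UA UH X).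
Qed.
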